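(* Let $K$ be a commutative Noetherian ring with $1$, let $A$ be a $K$-algebra (associative, not necessarily commutative or with $1$), and let $B$ be a $K$-subalgebra of $A$ such that $A/B$ is a finitely generated $K$-module. Then $A$ is finitely presented as a $K$-algebra if and only if $B$ is finitely presented as a $K$-algebra.
   Context: A $K$-algebra is a structure that is simultaneously an associative ring (not necessarily with identity) and a $K$-module, with $K$-bilinear multiplication. The free $K$-algebra $K\langle X\rangle$ on a set $X$ is the semigroup ring over $K$ of the free semigroup $X^+$ (non-commuting variables, no identity). A $K$-algebra is finitely generated if it is isomorphic to $K\langle X\rangle/I$ with $X$ finite and $I$ an ideal; it is finitely presented if moreover $I$ can be chosen finitely generated as an ideal. *)

(* Defs.v *)
(* Non-unital associative K-algebras are not a MathComp
   structure, so an algebra is given as a K-module A together with a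
   multiplication satisfying the axioms below. *)
From mathcomp Require Import all_boot all_order all_algebra.
Set Implicit Arguments. Unset Strict Implicit. Unset Printing Implicit Defensive.
Import GRing.Theory.
Local Open Scope ring_scope.

Definition is_ideal (K : comPzRingType) (I : K -> Prop) : Prop :=
  [/\ I 0, (forall x y, I x -> I y -> I (x + y)) & (forall c x, I x -> I (c * x))].

Definition noetherian (K : comPzRingType) : Prop :=
  forall I : K -> Prop, is_ideal I ->
    exists s : seq K, forall x, I x <->
      exists c : 'I_(size s) -> K, x = \sum_(i < size s) c i * s`_i.

Definition is_algebra (K : comPzRingType) (A : lmodType K) (mul : A -> A -> A) : Prop :=
  [/\ (forall x y z, mul x (mul y z) = mul (mul x y) z),
      (forall (k : K) x y z, mul (k *: x + y) z = k *: mul x z + mul y z) &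
      (forall (k : K) x y z, mul x (k *: y + z) = k *: mul x y + mul x z)].

Definition is_subalgebra (K : comPzRingType) (A : lmodType K) (mul : A -> A -> A)
    (B : A -> Prop) : Prop :=
  [/\ B 0, (forall x y, B x -> B y -> B (x + y)),
      (forall (k : K) x, B x -> B (k *: x)) &
      (forall x y, B x -> B y -> B (mul x y))].

Definition quotient_fin_gen (K : comPzRingType) (A : lmodType K) (B : A -> Prop) : Prop :=
  exists s : seq A, forall x : A,
    exists (c : 'I_(size s) -> K) (b : A), B b /\ x = \sum_(i < size s) c i *: s`_i + b.

(* ---------- the free algebra K<X>, X = 'I_n, without identity ----------
   An element of K<X> is represented by a formal K-linear combination of
   words (a list of (coefficient, word) pairs); two representations denote
   the same element iff they have the same coefficient on every word.
   Words must be nonempty (free semigroup X^+). *)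
Definition fpoly (K : comPzRingType) (n : nat) := seq (K * seq 'I_n).

Definition fpoly_wf (K : comPzRingType) n (p : fpoly K n) : bool := all (fun t => t.2 != [::]) p.

Definition fcoef (K : comPzRingType) n (p : fpoly K n) (w : seq 'I_n) : K :=
  \sum_(t <- p | t.2 == w) t.1.

Definition fpoly_eq (K : comPzRingType) n (p q : fpoly K n) : Prop := forall w, fcoef p w = fcoef q w.

Definition fpoly_sandwich (K : comPzRingType) n (c : K) (u : seq 'I_n) (r : fpoly K n) (v : seq 'I_n)
  : fpoly K n := [seq (c * t.1, u ++ t.2 ++ v) | t <- r].

Definition in_ideal (K : comPzRingType) n m (r : 'I_m -> fpoly K n) (p : fpoly K n) : Prop :=
  exists l : seq (K * seq 'I_n * 'I_m * seq 'I_n),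
    fpoly_eq p (flatten [seq fpoly_sandwich t.1.1.1 t.1.1.2 (r t.1.2) t.2 | t <- l]).

Definition word_eval (K : comPzRingType) (A : lmodType K) (mul : A -> A -> A) n (a : 'I_n -> A)
    (w : seq 'I_n) : A :=
  if w is x :: w' then foldl (fun acc i => mul acc (a i)) (a x) w' else 0.

Definition fpoly_eval (K : comPzRingType) (A : lmodType K) (mul : A -> A -> A) n (a : 'I_n -> A)
    (p : fpoly K n) : A :=
  \sum_(t <- p) t.1 *: word_eval mul a t.2.

(* The subalgebra S of A (S = everything for A itself) is finitely presented:
   there are finitely many generators a i in S such that the induced algebra
   map K<X> -> S is surjective and its kernel is the ideal generated by
   finitely many elements r j, i.e. S ~= K<X>/I with I finitely generated. *)
Definition fin_presented (K : comPzRingType) (A : lmodType K) (mul : A -> A -> A) (S : A -> Prop) : Prop :=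
  exists (n : nat) (a : 'I_n -> A) (m : nat) (r : 'I_m -> fpoly K n),
    [/\ (forall i, S (a i)),
        (forall j, fpoly_wf (r j)),
        (forall x, S x -> exists p, fpoly_wf p /\ fpoly_eval mul a p = x) &
        (forall p, fpoly_wf p -> (fpoly_eval mul a p = 0 <-> in_ideal r p))].

(* Main.v *)
Require Import Defs.
From HB Require Import structures.
From mathcomp Require Import all_boot all_order all_algebra.
From mathcomp Require Import generic_quotient.
From mathcomp Require boolp.

(** If [B] is presented by generators [b] and [A] is spanned by [s_1, ..., s_k]
modulo [B], then rewriting the products [s_i s_j], [s_i b_j], [b_j s_i], together
with generators of the K-linear relations of the [s_i] modulo [B] (finitely many,
K being Noetherian), presents [A].

For the converse, [L = {b in B | b A <= B}] is the kernel of the action of [B] on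
the Noetherian K-module [A/B], so it is a right ideal of [A] with [A/L] finitely
generated; by the first half it is enough to present [L].  Work in the
unitization of [A] and let [s] span it modulo [L], with 1 and the generators of
[A] among the [s_i].  Then [L] is generated by finitely many elements [z].  Right
multiplication by [s_j] on [A] lifts to an operator on the states
[(c, p)] of [K^k * K<Z>], where [(c, p)] stands for [sum c_i s_i + p(z)] and a word
[w z_i] is sent to [w] times a polynomial representing [z_i s_j].  Finitely many
true relations make the set of null states stable under these operators and kill
the relators of [A] acting on states; a polynomial [p] vanishing in [L] is lifted
to a relation of [A], which acts as zero, so that [p] is a consequence of the
chosen relations. *)

Set Implicit Arguments. Unset Strict Implicit. Unset Printing Implicit Defensive.
Import GRing.Theory.
Local Open Scope ring_scope.
Local Open Scope quotient_scope.

(** * The free algebra with identity *)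

Section FreeAlgebra.
Variables (K : comNzRingType) (n : nat).
Implicit Types (p q : fpoly K n) (w : seq 'I_n).

Lemma fcoef_cat p q w : fcoef (p ++ q) w = fcoef p w + fcoef q w.
Proof. by rewrite /fcoef big_cat. Qed.

Lemma fcoef_outdom p w : w \notin unzip2 p -> fcoef p w = 0.
Proof.
move=> wp; rewrite /fcoef big_seq_cond big1 // => t /andP[tp /eqP tw].
by case/negP: wp; rewrite -tw; apply: map_f.
Qed.

(** Terms are grouped by word. Any duplicate-free list [W] covering the words of [p] will do, so two
    polynomials can be compared over a common [W]. *)
Lemma fpoly_sum_coef (V : lmodType K) (f : seq 'I_n -> V) p (W : seq (seq 'I_n)) :
    uniq W -> {subset unzip2 p <= W} ->
  \sum_(t <- p) t.1 *: f t.2 = \sum_(w <- W) fcoef p w *: f w.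
Proof.
move=> uW sW; under [RHS]eq_bigr => w _ do rewrite /fcoef scaler_suml.
rewrite (exchange_big_dep predT) //= big_seq [RHS]big_seq; apply: eq_bigr => t tp.
rewrite [RHS](eq_bigr (fun=> t.1 *: f t.2)) => [|w /eqP-> //].
rewrite -big_filter (_ : [seq w <- W | _] = [:: t.2]) ?big_seq1 //.
rewrite (eq_filter (a2 := pred1 t.2)) => [|w]; last by rewrite /= eq_sym.
by rewrite filter_pred1_uniq // sW // map_f.
Qed.

Lemma fpoly_eq_sum (V : lmodType K) (f : seq 'I_n -> V) p q :
  fpoly_eq p q -> \sum_(t <- p) t.1 *: f t.2 = \sum_(t <- q) t.1 *: f t.2.
Proof.
move=> pq; pose W := undup (unzip2 p ++ unzip2 q).
rewrite !(@fpoly_sum_coef _ _ _ W) ?undup_uniq //; first by under eq_bigr do rewrite pq.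
- by move=> w wq; rewrite mem_undup mem_cat wq orbT.
- by move=> w wp; rewrite mem_undup mem_cat wp.
Qed.

(* Only the words that occur need to be compared, so equality is decidable. *)
Definition fpoly_eqb p q :=
  all (fun w => fcoef p w == fcoef q w) (unzip2 p ++ unzip2 q).

Lemma fpoly_eqP p q : reflect (fpoly_eq p q) (fpoly_eqb p q).
Proof.
apply: (iffP allP) => [pq w|pq w _]; last by rewrite pq.
case: (boolP (w \in unzip2 p ++ unzip2 q)) => [/pq/eqP //|].
by rewrite mem_cat negb_or => /andP[/fcoef_outdom-> /fcoef_outdom->].
Qed.

Lemma fpoly_eqb_equiv : equiv_class_of fpoly_eqb.
Proof.
split=> [p|p q|q p r].
- by apply/fpoly_eqP.
- by apply/fpoly_eqP/fpoly_eqP => pq w; rewrite pq.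
- by move=> /fpoly_eqP pq /fpoly_eqP qr; apply/fpoly_eqP => w; rewrite pq.
Qed.
Canonical fpoly_eqb_equivRel := EquivRelPack fpoly_eqb_equiv.

(** The quotient turns equality of coefficients into the Leibniz equality that ring structures
    require. *)
Definition freeAlg := {eq_quot fpoly_eqb}.
HB.instance Definition _ := Choice.on freeAlg.

Definition toFree p : freeAlg := \pi_({eq_quot fpoly_eqb}) p.
Definition ofFree (x : freeAlg) : fpoly K n := repr (x : {eq_quot fpoly_eqb}).
Definition coef (x : freeAlg) w := fcoef (ofFree x) w.

Lemma ofFreeK : cancel ofFree toFree. Proof. exact: reprK. Qed.

Lemma toFree_eq p q : toFree p = toFree q <-> fpoly_eq p q.
Proof. by split=> [/eqmodP/fpoly_eqP|pq]; last by apply/eqmodP/fpoly_eqP. Qed.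

Lemma coef_toFree p w : coef (toFree p) w = fcoef p w.
Proof. by have /toFree_eq := ofFreeK (toFree p); apply. Qed.

Lemma coefP x y : (forall w, coef x w = coef y w) -> x = y.
Proof. by move=> xy; rewrite -(ofFreeK x) -(ofFreeK y); apply/toFree_eq. Qed.

Definition scale_fpoly (k : K) p : fpoly K n := [seq (k * t.1, t.2) | t <- p].

Lemma fcoef_scale k p w : fcoef (scale_fpoly k p) w = k * fcoef p w.
Proof. by rewrite /fcoef big_map mulr_sumr. Qed.

Definition fa_add x y := toFree (ofFree x ++ ofFree y).
Definition fa_scale k x := toFree (scale_fpoly k (ofFree x)).
Definition fa_opp x := fa_scale (-1) x.
Definition fa_zero := toFree [::].

Lemma coef_add x y w : coef (fa_add x y) w = coef x w + coef y w.
Proof. by rewrite coef_toFree fcoef_cat. Qed.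
Lemma coef_scale k x w : coef (fa_scale k x) w = k * coef x w.
Proof. by rewrite coef_toFree fcoef_scale. Qed.
Lemma coef_zero w : coef fa_zero w = 0.
Proof. by rewrite coef_toFree /fcoef big_nil. Qed.

Lemma fa_addA : associative fa_add.
Proof. by move=> x y z; apply: coefP => w; rewrite !coef_add addrA. Qed.
Lemma fa_addC : commutative fa_add.
Proof. by move=> x y; apply: coefP => w; rewrite !coef_add addrC. Qed.
Lemma fa_add0 : left_id fa_zero fa_add.
Proof. by move=> x; apply: coefP => w; rewrite coef_add coef_zero add0r. Qed.
Lemma fa_addN : left_inverse fa_zero fa_opp fa_add.
Proof.
by move=> x; apply: coefP => w; rewrite coef_add coef_zero coef_scale mulN1r addNr.
Qed.
HB.instance Definition _ := GRing.isZmodule.Build freeAlg fa_addA fa_addC fa_add0 fa_addN.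

Lemma fa_scaleA a b x : fa_scale a (fa_scale b x) = fa_scale (a * b) x.
Proof. by apply: coefP => w; rewrite !coef_scale mulrA. Qed.
Lemma fa_scale1 : left_id 1 fa_scale.
Proof. by move=> x; apply: coefP => w; rewrite coef_scale mul1r. Qed.
Lemma fa_scaleDr : right_distributive fa_scale +%R.
Proof. by move=> k x y; apply: coefP => w; rewrite !(coef_scale, coef_add) mulrDr. Qed.
Lemma fa_scaleDl x : {morph fa_scale^~ x : a b / a + b}.
Proof. by move=> a b; apply: coefP => w; rewrite !(coef_scale, coef_add) mulrDl. Qed.
HB.instance Definition _ := GRing.Zmodule_isLmodule.Build K freeAlg
  fa_scaleA fa_scale1 fa_scaleDr fa_scaleDl.

Definition mono w : freeAlg := toFree [:: (1, w)].

Lemma toFreeE p : toFree p = \sum_(t <- p) t.1 *: mono t.2.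
Proof.
elim: p => [|[k w] p IHp]; first by rewrite big_nil.
rewrite big_cons -IHp; apply: coefP => v.
rewrite coef_add coef_scale !coef_toFree /fcoef !big_cons big_nil /=.
by case: ifP; rewrite ?addr0 ?mulr1 // mulr0 add0r.
Qed.

Lemma fa_ind (P : freeAlg -> Prop) :
    P 0 -> (forall x y, P x -> P y -> P (x + y)) -> (forall k x, P x -> P (k *: x)) ->
  (forall w, P (mono w)) -> forall x, P x.
Proof.
move=> P0 PD PZ Pm x; rewrite -(ofFreeK x) toFreeE.
by elim/big_ind: _ => // t _; apply: PZ.
Qed.

Section Lift.
Variables (V : lmodType K) (f : seq 'I_n -> V).

(** Universal property of the free module on words; the choice of a representative is harmless
    because the sum depends only on the coefficients. *)
Definition linext x : V := \sum_(t <- ofFree x) t.1 *: f t.2.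

Lemma linext_toFree p : linext (toFree p) = \sum_(t <- p) t.1 *: f t.2.
Proof. by apply: fpoly_eq_sum; apply/toFree_eq; rewrite ofFreeK. Qed.

Lemma linext_is_linear : linear linext.
Proof.
move=> k x y; rewrite linext_toFree big_cat /=; congr (_ + _).
rewrite -[LHS]/(linext (k *: x)) (linext_toFree (scale_fpoly k (ofFree x))) big_map scaler_sumr.
by under eq_bigr do rewrite -scalerA.
Qed.
HB.instance Definition _ := GRing.isLinear.Build K freeAlg V _ linext linext_is_linear.

Lemma linext_mono w : linext (mono w) = f w.
Proof. by rewrite linext_toFree big_seq1 scale1r. Qed.
End Lift.

Definition fa_mul x y := linext (fun v => linext (fun w => mono (v ++ w)) y) x.

Lemma fa_mulDl : left_distributive fa_mul +%R.
Proof. by move=> x y z; rewrite /fa_mul linearD. Qed.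
Lemma fa_mulZl k x y : k *: fa_mul x y = fa_mul (k *: x) y.
Proof. by rewrite /fa_mul linearZ. Qed.

Lemma fa_mul_linear x : linear (fa_mul x).
Proof.
move=> k y z; elim/fa_ind: x => [|x1 x2 IH1 IH2|a x IHx|w].
- by rewrite /fa_mul !linear0 addr0.
- by rewrite !fa_mulDl IH1 IH2 scalerDr addrACA.
- by rewrite -!fa_mulZl IHx scalerDr !scalerA mulrC.
- by rewrite /fa_mul !linext_mono linearP.
Qed.

Lemma fa_mulDr : right_distributive fa_mul +%R.
Proof. by move=> x y z; have := fa_mul_linear x 1 y z; rewrite !scale1r. Qed.
Lemma fa_mul0 x : fa_mul x 0 = 0.
Proof. by apply: (addrI (fa_mul x 0)); rewrite -fa_mulDr !addr0. Qed.
Lemma fa_mulZr k x y : k *: fa_mul x y = fa_mul x (k *: y).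
Proof. by have := fa_mul_linear x k y 0; rewrite !addr0 fa_mul0 addr0. Qed.

Lemma fa_mul_mono v w : fa_mul (mono v) (mono w) = mono (v ++ w).
Proof. by rewrite /fa_mul !linext_mono. Qed.

Lemma fa_mul0l x : fa_mul 0 x = 0.
Proof. by rewrite /fa_mul linear0. Qed.

Lemma fa_mulA : associative fa_mul.
Proof.
move=> x y z.
elim/fa_ind: x => [|x1 x2 IH1 IH2|k x IH|u].
- by rewrite !fa_mul0l.
- by rewrite !fa_mulDl IH1 IH2.
- by rewrite -!fa_mulZl IH.
elim/fa_ind: y => [|x1 x2 IH1 IH2|k x IH|v].
- by rewrite fa_mul0 fa_mul0l fa_mul0.
- by rewrite fa_mulDl !fa_mulDr fa_mulDl IH1 IH2.
- by rewrite -fa_mulZr -!fa_mulZl -fa_mulZr IH.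
elim/fa_ind: z => [|x1 x2 IH1 IH2|k x IH|w].
- by rewrite !fa_mul0.
- by rewrite !fa_mulDr IH1 IH2.
- by rewrite -!fa_mulZr IH.
by rewrite !fa_mul_mono catA.
Qed.
Lemma fa_mul1l : left_id (mono [::]) fa_mul.
Proof.
elim/fa_ind=> [|x1 x2 IH1 IH2|k x IH|w]; rewrite ?fa_mul0 ?fa_mul_mono //.
- by rewrite fa_mulDr IH1 IH2.
- by rewrite -fa_mulZr IH.
Qed.
Lemma fa_mul1r : right_id (mono [::]) fa_mul.
Proof.
elim/fa_ind=> [|x1 x2 IH1 IH2|k x IH|w]; rewrite ?fa_mul0l ?fa_mul_mono ?cats0 //.
- by rewrite fa_mulDl IH1 IH2.
- by rewrite -fa_mulZl IH.
Qed.
Lemma fa_one_neq0 : mono [::] != 0.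
Proof.
apply/eqP => /(congr1 (coef^~ [::])); rewrite coef_zero coef_toFree /fcoef big_cons big_nil /= addr0.
by apply/eqP/oner_neq0.
Qed.
HB.instance Definition _ := GRing.Zmodule_isNzRing.Build freeAlg
  fa_mulA fa_mul1l fa_mul1r fa_mulDl fa_mulDr fa_one_neq0.
HB.instance Definition _ := GRing.Lmodule_isLalgebra.Build K freeAlg fa_mulZl.
HB.instance Definition _ := GRing.Lalgebra_isAlgebra.Build K freeAlg fa_mulZr.

Lemma monoM v w : mono v * mono w = mono (v ++ w).
Proof. exact: fa_mul_mono. Qed.
Lemma mono_nil : mono [::] = 1. Proof. by []. Qed.

End FreeAlgebra.

Section Evaluation.
Variables (K : comNzRingType) (n : nat) (U : algType K) (a : 'I_n -> U).

Definition eval : freeAlg K n -> U := linext (fun w => \prod_(i <- w) a i).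
HB.instance Definition _ := GRing.Linear.on eval.

Lemma eval_mono w : eval (mono K w) = \prod_(i <- w) a i.
Proof. exact: linext_mono. Qed.

Lemma eval_is_monoid_morphism : monoid_morphism eval.
Proof.
split=> [|x y]; first by rewrite -mono_nil eval_mono big_nil.
elim/fa_ind: x => [|x1 x2 IH1 IH2|k x IH|v].
- by rewrite !(mul0r, linear0).
- by rewrite mulrDl !linearD /= IH1 IH2 mulrDl.
- by rewrite -scalerAl !linearZ /= IH scalerAl.
elim/fa_ind: y => [|x1 x2 IH1 IH2|k x IH|w].
- by rewrite !(mulr0, linear0).
- by rewrite mulrDr !linearD /= IH1 IH2 mulrDr.
- by rewrite -scalerAr !linearZ /= IH scalerAr.
by rewrite monoM !eval_mono big_cat.
Qed.
HB.instance Definition _ := GRing.isMonoidMorphism.Build (freeAlg K n) U eval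
  eval_is_monoid_morphism.
End Evaluation.

Lemma eval_ext (K : comNzRingType) n (U : algType K) (a b : 'I_n -> U) : a =1 b -> eval a =1 eval b.
Proof.
move=> ab p; elim/fa_ind: p => [|x y Hx Hy|k x Hx|w].
- by rewrite !linear0.
- by rewrite !linearD /= Hx Hy.
- by rewrite !linearZ /= Hx.
- by rewrite !eval_mono; apply: eq_bigr.
Qed.

Definition letter (K : comNzRingType) n (i : 'I_n) : freeAlg K n := mono K [:: i].

Lemma eval_letter (K : comNzRingType) n (U : algType K) (a : 'I_n -> U) i :
  eval a (letter K i) = a i.
Proof. by rewrite eval_mono big_seq1. Qed.

(** * Polynomials without constant term *)

Section Augmentation.
Variables (K : comNzRingType) (n : nat).
Implicit Types p q : freeAlg K n.

(* The augmentation ideal [aug] is the non-unital free algebra of the statement. *)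
Definition constant_term p : K^o := eval (fun=> 0) p.
Definition aug p := constant_term p = 0.

Lemma aug0 : aug 0. Proof. exact: linear0. Qed.
Lemma augD p q : aug p -> aug q -> aug (p + q).
Proof. by rewrite /aug /constant_term linearD /= => -> ->; rewrite addr0. Qed.
Lemma augZ k p : aug p -> aug (k *: p).
Proof. by rewrite /aug /constant_term linearZ /= => ->; rewrite scaler0. Qed.
Lemma augN p : aug p -> aug (- p).
Proof. by rewrite -scaleN1r; apply: augZ. Qed.
Lemma augB p q : aug p -> aug q -> aug (p - q).
Proof. by move=> ? ?; apply/augD/augN. Qed.
Lemma aug_mull p q : aug q -> aug (p * q).
Proof. by rewrite /aug /constant_term rmorphM /= => ->; rewrite mulr0. Qed.
Lemma aug_mulr p q : aug p -> aug (p * q).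
Proof. by rewrite /aug /constant_term rmorphM /= => ->; rewrite mul0r. Qed.
Lemma aug_letter i : aug (letter K i). Proof. exact: eval_letter. Qed.
Lemma aug_cons i w : aug (mono K (i :: w)).
Proof. by rewrite -cat1s -monoM; apply/aug_mulr/aug_letter. Qed.
Lemma aug_sum (I : Type) (r : seq I) (P : pred I) (F : I -> freeAlg K n) :
  (forall i, P i -> aug (F i)) -> aug (\sum_(i <- r | P i) F i).
Proof. by move=> augF; elim/big_ind: _ => //; [exact: aug0 | exact: augD]. Qed.

(** Subtracting the constant term is linear in [p], kills the empty word and fixes every other word,
    so linear induction applies to the difference. *)
Lemma aug_decomp (P : freeAlg K n -> Prop) :
    P 0 -> (forall x y, P x -> P y -> P (x + y)) -> (forall k x, P x -> P (k *: x)) ->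
    (forall w, w != [::] -> P (mono K w)) ->
  forall p, aug p -> P p.
Proof.
move=> P0 PD PZ Pm p; have: P (p - (constant_term p : K) *: (1 : freeAlg K n)); last first.
  by move=> + pa; rewrite pa scale0r subr0.
rewrite /constant_term; elim/fa_ind: p => [|x y IHx IHy|k x IH|w].
- by rewrite [eval _ _]linear0 scale0r subr0.
- by rewrite [eval _ _]linearD /= scalerDl opprD addrACA; apply: PD.
- have kZ (c : K^o) : (k *: c : K) *: (1 : freeAlg K n) = k *: ((c : K) *: 1).
    by rewrite scalerA.
  by rewrite [eval _ (k *: x)]linearZ /= kZ -scalerBr; apply: PZ.
case: w => [|i w]; first by rewrite mono_nil rmorph1 scale1r subrr.
by have := aug_cons i w; rewrite /aug /constant_term => ->; rewrite scale0r subr0; apply: Pm.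
Qed.

Lemma aug_rcons_ind (P : freeAlg K n -> Prop) :
    P 0 -> (forall x y, P x -> P y -> P (x + y)) -> (forall k x, P x -> P (k *: x)) ->
    (forall w i, P (mono K (rcons w i))) ->
  forall p, aug p -> P p.
Proof. by move=> P0 PD PZ Pm; apply: aug_decomp => // w; case/lastP: w. Qed.

Lemma aug_cons_ind (P : freeAlg K n -> Prop) :
    P 0 -> (forall x y, P x -> P y -> P (x + y)) -> (forall k x, P x -> P (k *: x)) ->
    (forall i w, P (mono K (i :: w))) ->
  forall p, aug p -> P p.
Proof. by move=> P0 PD PZ Pm; apply: aug_decomp => // -[]. Qed.

End Augmentation.

Lemma aug_eval (K : comNzRingType) m n (b : 'I_m -> freeAlg K n) p :
  (forall i, aug (b i)) -> aug p -> aug (eval b p).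
Proof.
move=> augb; elim/aug_cons_ind => [|x y Hx Hy|k x Hx|i w].
- by rewrite linear0; apply: aug0.
- by rewrite linearD; apply: augD.
- by rewrite linearZ; apply: augZ.
- by rewrite eval_mono big_cons; apply: aug_mulr.
Qed.

(** * Two-sided ideals and finite presentation inside a unital algebra *)

Section Ideal.
Variables (K : comNzRingType) (V : algType K).

(** Multipliers range over a unital algebra, so scalars are included: for [G] inside the
    augmentation ideal of a free algebra, this is the ideal generated by [G] in the non-unital free
    algebra. *)
Inductive ideal (G : V -> Prop) : V -> Prop :=
| ideal_gen g : G g -> ideal G g
| ideal0 : ideal G 0
| idealD x y : ideal G x -> ideal G y -> ideal G (x + y)
| ideal_mull a x : ideal G x -> ideal G (a * x)
| ideal_mulr x a : ideal G x -> ideal G (x * a).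

Variable G : V -> Prop.

Lemma idealZ k x : ideal G x -> ideal G (k *: x).
Proof. by move=> Gx; rewrite -[x]mul1r scalerAl; apply: ideal_mull. Qed.
Lemma idealN x : ideal G x -> ideal G (- x).
Proof. by rewrite -scaleN1r; apply: idealZ. Qed.
Lemma idealB x y : ideal G x -> ideal G y -> ideal G (x - y).
Proof. by move=> ? ?; apply/idealD/idealN. Qed.
Lemma ideal_sum (I : Type) (r : seq I) (P : pred I) (F : I -> V) :
  (forall i, P i -> ideal G (F i)) -> ideal G (\sum_(i <- r | P i) F i).
Proof. by move=> GF; elim/big_ind: _ => //; [exact: ideal0 | exact: idealD]. Qed.
Lemma ideal_trans x y : ideal G (x - y) -> ideal G y -> ideal G x.
Proof. by move=> xy Gy; rewrite -[x](subrK y); apply: idealD. Qed.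
Lemma ideal_sub (H : V -> Prop) x :
  (forall g, G g -> ideal H g) -> ideal G x -> ideal H x.
Proof.
move=> GH; elim=> // [|y z _ ? _ ?|b y _ ?|y b _ ?]; [exact: ideal0|..].
- exact: idealD.
- exact: ideal_mull.
- exact: ideal_mulr.
Qed.
End Ideal.

Lemma ideal_image (K : comNzRingType) (V W : algType K) (f : {lrmorphism V -> W}) G H x :
  (forall g, G g -> ideal H (f g)) -> ideal G x -> ideal H (f x).
Proof.
move=> GH; elim=> [//||y z _ ? _ ?|b y _ ?|y b _ ?].
- by rewrite rmorph0; apply: ideal0.
- by rewrite rmorphD; apply: idealD.
- by rewrite rmorphM; apply: ideal_mull.
- by rewrite rmorphM; apply: ideal_mulr.
Qed.

Lemma ideal_kernel (K : comNzRingType) (V W : algType K) (f : {lrmorphism V -> W}) G x :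
  (forall g, G g -> f g = 0) -> ideal G x -> f x = 0.
Proof.
move=> GH; elim=> [//||y z _ Hy _ Hz|b y _ Hy|y b _ Hy]; first exact: rmorph0.
- by rewrite rmorphD /= Hy Hz addr0.
- by rewrite rmorphM /= Hy mulr0.
- by rewrite rmorphM /= Hy mul0r.
Qed.

(** The counterpart of [fin_presented] for a non-unital subalgebra of a unital algebra, with [aug]
    in place of nonempty words. *)
Definition alg_fp (K : comNzRingType) (U : algType K) (S : U -> Prop) : Prop :=
  exists n (a : 'I_n -> U) (Q : seq (freeAlg K n)),
    [/\ (forall i, S (a i)), (forall q, q \in Q -> aug q),
        (forall x, S x -> exists p, aug p /\ eval a p = x) &
        (forall p, aug p -> eval a p = 0 <-> ideal (fun q => q \in Q) p)].

(** * From lists of terms to elements of the free algebra *)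

Section Translation.
Variables (K : comNzRingType) (n : nat).

Lemma toFree_cat (p q : fpoly K n) : toFree (p ++ q) = toFree p + toFree q.
Proof. by rewrite !toFreeE big_cat. Qed.

Lemma toFree_sandwich c u (r : fpoly K n) v :
  toFree (fpoly_sandwich c u r v) = c *: (mono K u * toFree r * mono K v).
Proof.
rewrite !toFreeE big_map mulr_sumr mulr_suml scaler_sumr; apply: eq_bigr => t _ /=.
by rewrite -scalerAr -scalerAl !monoM scalerA catA.
Qed.

(** Sums of sandwiches already form a two-sided ideal: by linearity a multiplier may be taken to be
    a word, which only lengthens the outer words. *)
Lemma in_idealP m (r : 'I_m -> fpoly K n) p :
  in_ideal r p <-> ideal (fun q => exists j, q = toFree (r j)) (toFree p).
Proof.
pose sw (t : K * seq 'I_n * 'I_m * seq 'I_n) : freeAlg K n :=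
  t.1.1.1 *: (mono K t.1.1.2 * toFree (r t.1.2) * mono K t.2).
have swE l : toFree (flatten [seq fpoly_sandwich t.1.1.1 t.1.1.2 (r t.1.2) t.2 | t <- l])
           = \sum_(t <- l) sw t.
  elim: l => [|t l IHl]; first by rewrite big_nil.
  by rewrite big_cons -IHl /= toFree_cat toFree_sandwich.
split=> [[l /toFree_eq ->]|].
  rewrite swE; apply: ideal_sum => t _; apply/idealZ/ideal_mulr/ideal_mull/ideal_gen.
  by exists t.1.2.
pose J x := exists l, x = \sum_(t <- l) sw t.
suff JP x : ideal (fun q => exists j, q = toFree (r j)) x -> J x.
  by case/JP=> l; rewrite -swE => /toFree_eq; exists l.
have J0 : J 0 by exists [::]; rewrite big_nil.
have JD y z : J y -> J z -> J (y + z).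
  by case=> l1 -> [l2 ->]; exists (l1 ++ l2); rewrite big_cat.
have JZ k y : J y -> J (k *: y).
  case=> l ->; exists [seq (k * t.1.1.1, t.1.1.2, t.1.2, t.2) | t <- l].
  by rewrite big_map scaler_sumr; apply: eq_bigr => t _; rewrite /sw /= scalerA.
elim=> {x} [_ [j ->]||y z _ Jy _ Jz|b y _ Jy|y b _ Jy]; auto.
- exists [:: (1, [::], j, [::])]; rewrite big_seq1 /sw /= !mono_nil.
  by rewrite scale1r mulr1 mul1r.
- elim/fa_ind: b => [|b c|k b|w]; rewrite ?mul0r ?mulrDl ?scalerAl -?scalerAl; auto.
  case: Jy => l ->; exists [seq (t.1.1.1, w ++ t.1.1.2, t.1.2, t.2) | t <- l].
  rewrite big_map mulr_sumr; apply: eq_bigr => t _.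
  by rewrite /sw /= -scalerAr -monoM !mulrA.
- elim/fa_ind: b => [|b c|k b|w]; rewrite ?mulr0 ?mulrDr -?scalerAr; auto.
  case: Jy => l ->; exists [seq (t.1.1.1, t.1.1.2, t.1.2, t.2 ++ w) | t <- l].
  rewrite big_map mulr_suml; apply: eq_bigr => t _.
  by rewrite /sw /= -scalerAl -monoM !mulrA.
Qed.

Lemma aug_toFree (p : fpoly K n) : fpoly_wf p -> aug (toFree p).
Proof.
move=> /allP wfp; rewrite toFreeE big_seq; apply: aug_sum => t /wfp.
by case: t => k [//|i w] _; apply/augZ/aug_cons.
Qed.

Lemma aug_toFreeP (x : freeAlg K n) : aug x -> exists2 p, fpoly_wf p & x = toFree p.
Proof.
elim/aug_decomp => [|x1 x2 [p1 w1 ->] [p2 w2 ->]|k _ [p wp ->]|w w0].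
- by exists [::].
- by exists (p1 ++ p2); [rewrite /fpoly_wf all_cat; apply/andP | rewrite toFree_cat].
- exists (scale_fpoly k p); first by rewrite /fpoly_wf all_map.
  by rewrite !toFreeE big_map scaler_sumr; apply: eq_bigr => t _; rewrite scalerA.
- by exists [:: (1, w)]; rewrite // /fpoly_wf /= w0.
Qed.
End Translation.

(** * Passing to the unitization *)

Section Unitization.
Variables (K : comNzRingType) (A : lmodType K) (mul : A -> A -> A).
Hypothesis algA : is_algebra mul.

Let mulA x y z : mul x (mul y z) = mul (mul x y) z. Proof. by case: algA. Qed.
Let mulZDl k x y z : mul (k *: x + y) z = k *: mul x z + mul y z.
Proof. by case: algA. Qed.
Let mulZDr k x y z : mul x (k *: y + z) = k *: mul x y + mul x z.
Proof. by case: algA. Qed.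
Let mulDl x y z : mul (x + y) z = mul x z + mul y z.
Proof. by have := mulZDl 1 x y z; rewrite !scale1r. Qed.
Let mulDr x y z : mul x (y + z) = mul x y + mul x z.
Proof. by have := mulZDr 1 x y z; rewrite !scale1r. Qed.
Let mul0l x : mul 0 x = 0.
Proof. by apply: (addrI (mul 0 x)); rewrite -mulDl !addr0. Qed.
Let mul0r x : mul x 0 = 0.
Proof. by apply: (addrI (mul x 0)); rewrite -mulDr !addr0. Qed.
Let mulZl k x y : mul (k *: x) y = k *: mul x y.
Proof. by have := mulZDl k x 0 y; rewrite !addr0 mul0l addr0. Qed.
Let mulZr k x y : mul x (k *: y) = k *: mul x y.
Proof. by have := mulZDr k x y 0; rewrite !addr0 mul0r addr0. Qed.

(** The proof of [is_algebra] is an argument so that the ring structure declared on this type can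
    depend on it. *)
Definition unitization of is_algebra mul : Type := (K^o * A)%type.
Local Notation U := (unitization algA).
HB.instance Definition _ := GRing.Lmodule.copy U (K^o * A)%type.

Definition unit_one : U := (1, 0).
Definition unit_mul (x y : U) : U :=
  (x.1 * y.1, x.1 *: y.2 + y.1 *: x.2 + mul x.2 y.2).

Lemma unit_mulA : associative unit_mul.
Proof.
move=> [k x] [l y] [m z]; congr pair; rewrite /= ?mulrA // !mulDl !mulDr !mulZl !mulZr.
rewrite !scalerDr !mulA !scalerA !addrA [RHS](ACl (1*2*5*3*6*4*7)).
by rewrite [m * k]mulrC [m * l]mulrC.
Qed.
Lemma unit_mul1l : left_id unit_one unit_mul.
Proof. by case=> k x; rewrite /unit_mul /= mul1r scale1r scaler0 mul0l !addr0. Qed.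
Lemma unit_mul1r : right_id unit_one unit_mul.
Proof. by case=> k x; rewrite /unit_mul /= mulr1 scale1r scaler0 mul0r add0r addr0. Qed.
Lemma unit_mulDl : left_distributive unit_mul +%R.
Proof.
move=> [k x] [l y] [m z]; congr pair; rewrite /= ?mulrDl // mulDl scalerDl scalerDr.
by rewrite [RHS]addrACA; congr (_ + _); rewrite addrACA.
Qed.
Lemma unit_mulDr : right_distributive unit_mul +%R.
Proof.
move=> [k x] [l y] [m z]; congr pair; rewrite /= ?mulrDr // mulDr scalerDl scalerDr.
by rewrite [RHS]addrACA; congr (_ + _); rewrite addrACA.
Qed.
Lemma unit_one_neq0 : unit_one != 0.
Proof. by apply/eqP => /(congr1 fst)/eqP; rewrite oner_eq0. Qed.
HB.instance Definition _ := GRing.Zmodule_isNzRing.Build U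
  unit_mulA unit_mul1l unit_mul1r unit_mulDl unit_mulDr unit_one_neq0.
Lemma unit_mulZl k (x y : U) : k *: unit_mul x y = unit_mul (k *: x) y.
Proof.
by congr pair => /=; rewrite ?scalerAl // !scalerDr mulZl !scalerA [k * y.1]mulrC.
Qed.
HB.instance Definition _ := GRing.Lmodule_isLalgebra.Build K U unit_mulZl.
Lemma unit_mulZr k (x y : U) : k *: unit_mul x y = unit_mul x (k *: y).
Proof.
by congr pair => /=; rewrite ?scalerAr // !scalerDr mulZr !scalerA [x.1 * k]mulrC.
Qed.
HB.instance Definition _ := GRing.Lalgebra_isAlgebra.Build K U unit_mulZr.

Definition embed (x : A) : U := (0, x).

Lemma embedM x y : embed x * embed y = embed (mul x y).
Proof. by congr pair => /=; rewrite ?mulr0 // !scale0r !add0r. Qed.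

Definition embed_pred (B : A -> Prop) (x : U) := x.1 = 0 /\ B x.2.

Lemma embed_predP B x : embed_pred B x <-> exists2 b, B b & x = embed b.
Proof. by split=> [[]|[b Bb ->]]; [case: x => _ x /= -> ?; exists x | split]. Qed.

Lemma embed_is_linear : linear embed.
Proof. by move=> k x y; congr pair; rewrite /= scaler0 addr0. Qed.
HB.instance Definition _ := GRing.isLinear.Build K A U _ embed embed_is_linear.

(** Nonemptiness matters: the empty word evaluates to [1] in the unitization but to [0] under
    [word_eval]. *)
Lemma eval_embed_mono n (a : 'I_n -> A) w :
  w != [::] -> eval (embed \o a) (mono K w) = embed (word_eval mul a w).
Proof.
elim/last_ind: w => // w i IHw _; rewrite eval_mono.
case: w IHw => [|j w] IHw; first by rewrite big_seq1.
by rewrite -cats1 big_cat big_seq1 -eval_mono IHw //= embedM foldl_cat.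
Qed.

Lemma eval_embed n (a : 'I_n -> A) p :
  fpoly_wf p -> eval (embed \o a) (toFree p) = embed (fpoly_eval mul a p).
Proof.
move=> /allP wfp; rewrite toFreeE !linear_sum /= big_seq [RHS]big_seq.
by apply: eq_bigr => t /wfp tw; rewrite !linearZ /= eval_embed_mono.
Qed.

Lemma embed0P x : embed x = 0 <-> x = 0.
Proof. by split=> [[]|->]. Qed.

Lemma fin_presented_embed B : fin_presented mul B <-> alg_fp (embed_pred B).
Proof.
split=> [[n [a [m [r [aB wfr surj ker]]]]]|[n [a [Q [aB augQ surj ker]]]]].
  exists n, (embed \o a), [seq toFree (r j) | j <- enum 'I_m]; split.
  - by move=> i; split; last exact: aB.
  - by move=> q /mapP[j _ ->]; apply: aug_toFree.
  - move=> x /embed_predP[b /surj[p [wfp <-]] ->]; exists (toFree p).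
    by split; [apply: aug_toFree | apply: eval_embed].
  move=> q /aug_toFreeP[p wfp ->]; rewrite eval_embed // embed0P ker // in_idealP.
  split; apply: ideal_sub => g; first by case=> j ->; apply/ideal_gen/map_f/mem_enum.
  by case/mapP=> j _ ->; apply: ideal_gen; exists j.
(* Elements of [embed_pred B] have zero scalar part, so the generators come from [A]. *)
have aE : a =1 embed \o (fun i => (a i).2).
  by move=> i /=; have [] := aB i; case: (a i) => /= k x ->.
have evE := eval_ext aE.
have /boolp.choice[r rP] (j : 'I_(size Q)) : exists p, fpoly_wf p /\ Q`_j = toFree p.
  by have /augQ/aug_toFreeP[p] := mem_nth 0 (ltn_ord j); exists p.
have QP q : q \in Q <-> exists j, q = toFree (r j).
  split=> [/(nthP 0)[j jQ <-]|[j ->]]; last by rewrite -(rP j).2 mem_nth.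
  by exists (Ordinal jQ); rewrite -(rP _).2.
exists n, (fun i => (a i).2), (size Q), r; split.
- by move=> i; have [] := aB i.
- by move=> j; have [] := rP j.
- move=> x Bx; have [|p []] := surj (embed x); first by split.
  case/aug_toFreeP=> q wfq ->; rewrite evE eval_embed // => -[<-].
  by exists q.
move=> p wfp; rewrite -embed0P -eval_embed // -evE ker ?in_idealP; last exact: aug_toFree.
by split; apply: ideal_sub => q /QP; apply: ideal_gen.
Qed.
End Unitization.

(** * Finitely generated modules *)

Section LinearCombination.
Variables (K : comNzRingType) (V : lmodType K).

Definition lincomb k (c : 'rV[K]_k) (s : 'I_k -> V) : V := \sum_i c 0 i *: s i.

Lemma lincombP k (s : 'I_k -> V) a c d :
  lincomb (a *: c + d) s = a *: lincomb c s + lincomb d s.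
Proof.
rewrite /lincomb scaler_sumr -big_split; apply: eq_bigr => i _ /=.
by rewrite !mxE scalerDl scalerA.
Qed.
Lemma lincomb0 k (s : 'I_k -> V) : lincomb 0 s = 0.
Proof. by rewrite /lincomb big1 // => i _; rewrite mxE scale0r. Qed.
Lemma lincombD k (s : 'I_k -> V) c d : lincomb (c + d) s = lincomb c s + lincomb d s.
Proof. by have := lincombP s 1 c d; rewrite !scale1r. Qed.
Lemma lincombZ k (s : 'I_k -> V) a c : lincomb (a *: c) s = a *: lincomb c s.
Proof. by have := lincombP s a c 0; rewrite lincomb0 !addr0. Qed.

Lemma lincomb_delta k (s : 'I_k -> V) i : lincomb (delta_mx 0 i) s = s i.
Proof.
rewrite /lincomb (bigD1 i) //= mxE !eqxx scale1r big1 ?addr0 // => j /negPf ji.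
by rewrite mxE ji andbF scale0r.
Qed.

Lemma lincomb_mulmx h k (l : 'rV[K]_h) (C : 'M_(h, k)) (s : 'I_k -> V) :
  lincomb (l *m C) s = lincomb l (fun i => lincomb (row i C) s).
Proof.
rewrite /lincomb; under eq_bigr do rewrite mxE scaler_suml.
rewrite exchange_big; apply: eq_bigr => i _; rewrite scaler_sumr.
by apply: eq_bigr => j _; rewrite mxE scalerA.
Qed.

Lemma lincomb_row_mx h k (l : 'rV[K]_h) (c : 'rV_k) (s : 'I_(h + k) -> V) :
  lincomb (row_mx l c) s =
  lincomb l (fun i => s (lshift k i)) + lincomb c (fun i => s (rshift h i)).
Proof.
rewrite /lincomb big_split_ord; congr (_ + _).
  by apply: eq_bigr => i _; rewrite row_mxEl.
by apply: eq_bigr => i _; rewrite row_mxEr.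
Qed.
End LinearCombination.

Lemma linear_lincomb (K : comNzRingType) (V W : lmodType K) (f : {linear V -> W}) k
    (c : 'rV_k) s : f (lincomb c s) = lincomb c (f \o s).
Proof. by rewrite linear_sum; apply: eq_bigr => i _; rewrite linearZ. Qed.

Lemma eq_lincomb (K : comNzRingType) (V : lmodType K) k (c : 'rV[K]_k) (s t : 'I_k -> V) :
  s =1 t -> lincomb c s = lincomb c t.
Proof. by move=> st; apply: eq_bigr => i _; rewrite st. Qed.

Definition submodule_pred (K : comNzRingType) (V : lmodType K) (P : V -> Prop) :=
  [/\ P 0, (forall x y, P x -> P y -> P (x + y)) & (forall k x, P x -> P (k *: x))].

Lemma submodule_lincomb (K : comNzRingType) (V : lmodType K) (P : V -> Prop) k
    (c : 'rV_k) s : submodule_pred P -> (forall i, P (s i)) -> P (lincomb c s).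
Proof. by case=> P0 PD PZ Ps; apply: big_ind => // i _; apply: PZ. Qed.

(** Induction on [n]: the first coordinates of vectors of [P] form an ideal, whose generators lift
    to vectors [g] of [P]. Subtracting a combination of these leaves a vector of [P] with first
    coordinate [0], covered by the induction hypothesis. *)
Lemma noetherian_rV (K : comNzRingType) n (P : 'rV[K]_n -> Prop) :
    noetherian K -> submodule_pred P ->
  exists h (C : 'M_(h, n)), forall v, P v <-> exists l, v = l *m C.
Proof.
move=> noethK; elim: n P => [|n IHn]; last rewrite -[n.+1]/(1 + n)%N; move=> P [P0 PD PZ].
  exists 0%N, 0 => v; rewrite [v]thinmx0; split=> // _.
  by exists 0; rewrite mul0mx.
have [|s sP] := noethK (fun x => exists2 v, P v & v 0 0 = x).
  split; first by exists 0; rewrite ?mxE.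
  - by move=> _ _ [v Pv <-] [w Pw <-]; exists (v + w); rewrite ?mxE //; apply: PD.
  - by move=> c _ [v Pv <-]; exists (c *: v); rewrite ?mxE //; apply: PZ.
have /boolp.choice[g gP] (i : 'I_(size s)) : exists v, P v /\ v 0 0 = s`_i.
  have [|v Pv v0] := (sP s`_i).2; last by exists v.
  exists (fun j => (i == j)%:R); rewrite (bigD1 i) //= eqxx mul1r big1 ?addr0 //.
  by move=> j; rewrite eq_sym => /negPf->; rewrite mul0r.
pose P' (w : 'rV_n) := P (row_mx (0 : 'rV_1) w : 'rV_(1 + n)).
have [|h [C CP]] := IHn P'.
  split=> [|v w Pv Pw|c v Pv].
  - by rewrite /P' row_mx0.
  - by have := PD _ _ Pv Pw; rewrite /P' add_row_mx addr0.
  - by have := PZ c _ Pv; rewrite /P' scale_row_mx scaler0.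
pose H : 'M_(size s, 1 + n) := \matrix_i g i.
have PH l : P (l *m H).
  rewrite mulmx_sum_row; apply: big_ind => // i _; rewrite rowK.
  by apply: PZ; case: (gP i).
exists (size s + h)%N, (col_mx H (row_mx (0 : 'cV_h) C)) => v; split=> [Pv|[l ->]].
  have [|c vc] := (sP (v 0 0)).1; first by exists v.
  pose w : 'rV_(1 + n) := v - (\row_i c i) *m H.
  have w0 : lsubmx w = 0.
    apply/rowP => i; rewrite ord1 !mxE lshift0 vc; apply/eqP; rewrite subr_eq0; apply/eqP.
    by apply: eq_bigr => j _; rewrite !mxE (gP j).2.
  have Pw : P w by apply: PD => //; rewrite -scaleN1r; apply/PZ/PH.
  have [|l wl] := (CP (rsubmx w)).1; first by rewrite /P' -w0 hsubmxK.
  exists (row_mx (\row_i c i) l); rewrite mul_row_col mul_mx_row mulmx0 -wl -w0 hsubmxK.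
  by rewrite addrC subrK.
rewrite -[l]hsubmxK mul_row_col mul_mx_row mulmx0; apply: PD; first exact: PH.
by apply/CP; exists (rsubmx l).
Qed.

Section FinitePredicate.
Variable T : eqType.

(** Relators are described below by existential statements; this supplies the list that [alg_fp]
    asks for. *)
Definition finite_pred (P : T -> Prop) := exists s : seq T, forall x, P x <-> x \in s.

Lemma finite_pred_or P Q : finite_pred P -> finite_pred Q -> finite_pred (fun x => P x \/ Q x).
Proof.
move=> [s sP] [t tQ]; exists (s ++ t) => x; rewrite mem_cat sP tQ.
by split=> [|/orP]; [case=> ->; rewrite ?orbT|].
Qed.

Lemma finite_pred_eq y : finite_pred (fun x => x = y).
Proof. by exists [:: y] => x; rewrite inE; split=> /eqP. Qed.

Lemma finite_pred_bigex (I : eqType) (r : seq I) (P : I -> T -> Prop) :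
  (forall i, finite_pred (P i)) -> finite_pred (fun x => exists2 i, i \in r & P i x).
Proof.
move=> /boolp.choice[s sP]; exists (flatten (map s r)) => x.
split=> [[i ir /sP xs]|/flatten_mapP[i ir /sP]]; last by exists i.
by apply/flatten_mapP; exists i.
Qed.

Lemma finite_pred_ex (I : finType) (P : I -> T -> Prop) :
  (forall i, finite_pred (P i)) -> finite_pred (fun x => exists i, P i x).
Proof.
move=> /(finite_pred_bigex (enum I))[s sP]; exists s => x; rewrite -sP.
by split=> [[i]|[i _]]; exists i; rewrite ?mem_enum.
Qed.
End FinitePredicate.

Section Subalgebra.
Variables (K : comNzRingType) (U : algType K).

Definition subalgebra_pred (S : U -> Prop) :=
  submodule_pred S /\ forall x y, S x -> S y -> S (x * y).

(** A constant term is excluded because [S] need not contain [1]. *)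
Lemma subalgebra_eval (S : U -> Prop) n (a : 'I_n -> U) p :
  subalgebra_pred S -> (forall i, S (a i)) -> aug p -> S (eval a p).
Proof.
case=> [[S0 SD SZ] SM] Sa; elim/aug_rcons_ind => [|x y Sx Sy|k x Sx|w i].
- by rewrite linear0.
- by rewrite linearD; apply: SD.
- by rewrite linearZ; apply: SZ.
rewrite eval_mono; elim/last_ind: w i => [|w j IHw] i; first by rewrite big_seq1.
by rewrite -cats1 big_cat big_seq1; apply: SM.
Qed.

Lemma eval_comp m n (a : 'I_n -> U) (b : 'I_m -> freeAlg K n) p :
  eval a (eval b p) = eval (fun i => eval a (b i)) p.
Proof.
elim/fa_ind: p => [|x y Hx Hy|k x Hx|w].
- by rewrite !linear0.
- by rewrite !linearD /= Hx Hy.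
- by rewrite !linearZ /= Hx.
- by rewrite !eval_mono rmorph_prod.
Qed.

End Subalgebra.

Lemma submodule_aug (K : comNzRingType) n : submodule_pred (@aug K n).
Proof. by split; [apply: aug0 | apply: augD | apply: augZ]. Qed.

Lemma submodule_comb (K : comNzRingType) (V : lmodType K) (P : V -> Prop) k (s : 'I_k -> V) :
  submodule_pred P -> submodule_pred (fun c => P (lincomb c s)).
Proof.
case=> P0 PD PZ; split=> [|c d Pc Pd|x c Pc].
- by rewrite lincomb0.
- by rewrite lincombD; apply: PD.
- by rewrite lincombZ; apply: PZ.
Qed.

(** * Ascent: from a subalgebra to a finite extension *)

Section Extension.
Variables (K : comNzRingType) (U : algType K) (S T : U -> Prop) (k : nat) (s : 'I_k -> U).
Hypotheses (noethK : noetherian K) (subS : subalgebra_pred S) (subT : subalgebra_pred T).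
Hypotheses (TS : forall x, T x -> S x) (Ss : forall i, S (s i)).
Hypothesis Sspan : forall x, S x -> exists c t, T t /\ x = lincomb c s + t.

(** Modulo the relations, every polynomial without constant term has a normal form: a combination of
    the letters for [s] plus a polynomial in the letters for [b]. A vanishing normal form is then
    reduced, by the relations on coefficients, to a relation of [T]. *)
Lemma alg_fp_extension : alg_fp T -> alg_fp S.
Proof.
case=> n [b [R [Tb augR surjT kerT]]].
have [modT mulT] := subT; have [modS mulS] := subS.
have Sb i : S (b i) by apply: TS.
have normal x : S x -> exists ct : 'rV_k * freeAlg K n,
    aug ct.2 /\ x = lincomb ct.1 s + eval b ct.2.
  by move=> /Sspan[c [_ [/surjT[p [augp <-]] ->]]]; exists (c, p).
have /boolp.choice[ss ssP] (ij : 'I_k * 'I_k) := normal _ (mulS _ _ (Ss ij.1) (Ss ij.2)).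
have /boolp.choice[sb sbP] (ij : 'I_k * 'I_n) := normal _ (mulS _ _ (Ss ij.1) (Sb ij.2)).
have /boolp.choice[bs bsP] (ij : 'I_n * 'I_k) := normal _ (mulS _ _ (Sb ij.1) (Ss ij.2)).
(* The rows of [C] generate the coefficient vectors [c] with [lincomb c s] in [T]. *)
have [h [C CP]] := noetherian_rV noethK (submodule_comb s modT).
have /boolp.choice[u uP] (l : 'I_h) : exists p, aug p /\ eval b p = lincomb (row l C) s.
  by apply/surjT/CP; exists (delta_mx 0 l); rewrite -rowE.
pose B i : freeAlg K (n + k) := letter K (lshift k i).
pose X i : freeAlg K (n + k) := letter K (rshift n i).
pose g i := match split i with inl i => b i | inr i => s i end.
have gB i : eval g (B i) = b i.
  by rewrite eval_letter /g -[lshift _ _]/(unsplit (inl _)) unsplitK.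
have gX i : eval g (X i) = s i.
  by rewrite eval_letter /g -[rshift _ _]/(unsplit (inr _)) unsplitK.
pose io := eval B.
have g_io p : eval g (io p) = eval b p by rewrite eval_comp; apply: eval_ext => i.
have aug_io p : aug p -> aug (io p).
  by apply: aug_eval => i; apply: aug_letter.
have augX i : aug (X i) by apply: aug_letter.
have aug_linX c : aug (lincomb c X) by apply: submodule_lincomb (submodule_aug _ _) _.
have g_linX c : eval g (lincomb c X) = lincomb c s.
  by rewrite linear_lincomb; apply: eq_lincomb => i /=.
pose nf (ct : 'rV_k * freeAlg K n) := lincomb ct.1 X + io ct.2.
pose G q := (exists2 r, r \in R & q = io r) \/
  (exists ij, q = X ij.1 * X ij.2 - nf (ss ij)) \/
  (exists ij, q = X ij.1 * B ij.2 - nf (sb ij)) \/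
  (exists ij, q = B ij.1 * X ij.2 - nf (bs ij)) \/
  (exists l, q = lincomb (row l C) X - io (u l)).
have [Q QP] : finite_pred G.
  apply: finite_pred_or; first by apply: finite_pred_bigex => i; apply: finite_pred_eq.
  do 3![apply: finite_pred_or; first by apply: finite_pred_ex => i; apply: finite_pred_eq].
  by apply: finite_pred_ex => i; apply: finite_pred_eq.
have R0 r : r \in R -> eval b r = 0.
  by move=> rR; apply/kerT; [apply: augR | apply: ideal_gen].
have g_nf ct : eval g (nf ct) = lincomb ct.1 s + eval b ct.2.
  by rewrite linearD /= g_linX g_io.
have G0 q : G q -> aug q /\ eval g q = 0.
  case=> [[r rR ->]|[[ij ->]|[[ij ->]|[[ij ->]|[l ->]]]]].
  - by rewrite g_io R0 //; split=> //; apply/aug_io/augR.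
  - have [augt e] := ssP ij; split; last by rewrite linearB rmorphM /= g_nf !gX e subrr.
    by apply: augB; [apply: aug_mull | apply: augD => //; apply: aug_io].
  - have [augt e] := sbP ij; split; last by rewrite linearB rmorphM /= g_nf gX gB e subrr.
    by apply: augB; [apply: aug_mulr | apply: augD => //; apply: aug_io].
  - have [augt e] := bsP ij; split; last by rewrite linearB rmorphM /= g_nf gX gB e subrr.
    by apply: augB; [apply: aug_mull | apply: augD => //; apply: aug_io].
  - have [augt e] := uP l; split; last by rewrite linearB /= g_linX g_io e subrr.
    by apply: augB => //; apply: aug_io.
(* [D] collects the polynomials congruent to a normal form. *)
pose D p := exists ct, aug ct.2 /\ ideal G (p - nf ct).
have D0 : D 0.
  exists (0, 0); split; first exact: aug0.
  by rewrite /nf /= lincomb0 [io 0]linear0 addr0 subr0; apply: ideal0.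
have DD p q : D p -> D q -> D (p + q).
  move=> [ct [a1 i1]] [ct' [a2 i2]]; exists (ct.1 + ct'.1, ct.2 + ct'.2).
  split; first exact: augD.
  by rewrite /nf /= lincombD [io (_ + _)]linearD /= [X in _ - X]addrACA opprD addrACA; apply: idealD.
have DZ a p : D p -> D (a *: p).
  move=> [ct [a1 i1]]; exists (a *: ct.1, a *: ct.2); split; first exact: augZ.
  by rewrite /nf /= lincombZ [io _]linearZ /= -scalerDr -scalerBr; apply: idealZ.
have modD : submodule_pred D by split.
have D_trans p q : ideal G (p - q) -> D q -> D p.
  move=> pq [ct [a1 i1]]; exists ct; split=> //.
  by rewrite -[p](subrK q) -addrA; apply: idealD.
have D_io p : aug p -> D (io p).
  by move=> augp; exists (0, p); split; rewrite // /nf lincomb0 add0r subrr; apply: ideal0.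
have DX i : D (X i).
  exists (delta_mx 0 i, 0); split; first exact: aug0.
  by rewrite /nf /= [io 0]linear0 addr0 lincomb_delta subrr; apply: ideal0.
have D_nf ct : aug ct.2 -> D (nf ct).
  by move=> augt; apply: DD; [apply: submodule_lincomb | apply: D_io].
(* Induction on the word: rewriting [X i * B j] gives letters [X l] in front of a shorter word, plus
   a polynomial in the [B] alone. *)
have DXio i q : D (X i * io q).
  elim/fa_ind: q i => [|x y Hx Hy|a x Hx|w] i.
  - by rewrite [io _]linear0 mulr0.
  - by rewrite [io _]linearD mulrDr; apply: DD.
  - by rewrite [io _]linearZ -scalerAr; apply: DZ.
  elim: w i => [|j w IHw] i; first by rewrite mono_nil [io _]rmorph1 mulr1.
  rewrite -cat1s -monoM [io _]rmorphM -[mono K [:: j]]/(letter K j) /= eval_letter mulrA.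
  have [augt _] := sbP (i, j); apply: (D_trans _ (nf (sb (i, j)) * io (mono K w))).
    by rewrite -mulrBl; apply/ideal_mulr/ideal_gen; right; right; left; exists (i, j).
  rewrite mulrDl; apply/DD; last by rewrite -rmorphM; apply/D_io/aug_mulr.
  rewrite mulr_suml; apply: (big_ind D) => // l _; rewrite -scalerAl; apply: DZ; exact: IHw.
have DXX i j : D (X i * X j).
  have [augt _] := ssP (i, j); apply: (D_trans _ (nf (ss (i, j)))); last exact: D_nf.
  by apply: ideal_gen; right; left; exists (i, j).
have DBX i j : D (B i * X j).
  have [augt _] := bsP (i, j); apply: (D_trans _ (nf (bs (i, j)))); last exact: D_nf.
  by apply: ideal_gen; right; right; right; left; exists (i, j).
have D_letter i p : D p -> D (letter K i * p).
  move=> [[c q] [/= augq cq]].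
  have /D_trans : ideal G (letter K i * p - letter K i * nf (c, q)).
    by rewrite -mulrBr; apply: ideal_mull.
  apply.
  have [[j ->]|[j ->]] : (exists j, i = lshift k j) \/ exists j, i = rshift n j.
    by case: (splitP i) => j ij; [left|right]; exists j; apply: val_inj.
  - rewrite mulrDr mulr_sumr; apply/DD; last first.
      rewrite -[letter K _]/(B j) -(eval_letter B j) -rmorphM /=.
      by apply/D_io/aug_mull.
    by apply: (big_ind D) => // l _; rewrite -scalerAr; exact/DZ/DBX.
  - rewrite mulrDr mulr_sumr; apply/DD; last exact: DXio.
    by apply: (big_ind D) => // l _; rewrite -scalerAr; exact/DZ/DXX.
have D_aug p : aug p -> D p.
  elim/aug_cons_ind=> // i w; elim: w i => [|j w IHw] i; last first.
    by rewrite -cat1s -monoM; apply: D_letter.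
  have [[j ->]|[j ->]] : (exists j, i = lshift k j) \/ exists j, i = rshift n j.
    by case: (splitP i) => j ij; [left|right]; exists j; apply: val_inj.
    by rewrite -[mono _ _]/(B j) -(eval_letter B j); apply/D_io/aug_letter.
  exact: DX.
exists (n + k)%N, g, Q; split.
- by move=> i; rewrite /g; case: split.
- by move=> q /QP/G0[].
- move=> x Sx; have [ct [augt ->]] := normal x Sx.
  by exists (nf ct); rewrite g_nf; split=> //; apply/augD/aug_io.
move=> p augp; split; last first.
  by apply: (ideal_kernel (f := eval g)) => q /QP/G0[].
have [ct [augt pct]] := D_aug p augp.
have: eval g (p - nf ct) = 0 by apply: ideal_kernel pct => q /G0[].
rewrite linearB /= g_nf => + p0; rewrite p0 sub0r => /eqP; rewrite oppr_eq0 => /eqP ct0.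
(* The normal form vanishes, so its combination of the [s i] is minus an element of [T] and its
   coefficients lie in the row space of [C]. *)
have [|l cl] := (CP ct.1).1.
  rewrite -[lincomb _ _](addrK (eval b ct.2)) ct0 sub0r -scaleN1r -linearZ /=.
  by apply: subalgebra_eval => //; apply: augZ.
have luP : ideal G (lincomb ct.1 X - io (lincomb l u)).
  rewrite cl lincomb_mulmx [io _]linear_lincomb -sumrB; apply: ideal_sum => i _.
  rewrite -scalerBr; apply/idealZ/ideal_gen; do 4!right; by exists i.
have ioG q : ideal (fun r => r \in R) q -> ideal G (io q).
  by apply: (ideal_image (f := io)) => r rR; apply: ideal_gen; left; exists r.
have aug_lu : aug (lincomb l u).
  by apply: submodule_lincomb (submodule_aug _ _) _ => i; have [] := uP i.
apply: (ideal_sub (G := G)) => [q /QP|]; first exact: ideal_gen.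
apply: (ideal_trans pct); rewrite /nf -[lincomb _ _](subrK (io (lincomb l u))) -addrA.
(* Trading the coefficients for [lincomb l u] leaves a polynomial in the letters of [T] alone,
   settled by [kerT]. *)
apply: idealD luP _; rewrite -linearD; apply/ioG/kerT; first exact: augD.
rewrite linearD /= -ct0; congr (_ + _); rewrite cl lincomb_mulmx linear_lincomb.
by apply: eq_lincomb => i; have [] := uP i.
Qed.
End Extension.

(** * Descent: from an algebra to a right ideal of finite corank *)

Section LastSubst.
Variables (K : comNzRingType) (m : nat) (f : 'I_m -> freeAlg K m).

(** The augmentation ideal is a free left module on the letters; on it this is the left-linear map
    sending letter [i] to [f i]. The empty word goes to [0], whence the conditions [aug] below. *)
Definition last_subst : freeAlg K m -> freeAlg K m :=
  linext (fun w => if rev w is i :: v then mono K (rev v) * f i else 0).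
HB.instance Definition _ := GRing.Linear.on last_subst.

Lemma last_subst_rcons w i : last_subst (mono K (rcons w i)) = mono K w * f i.
Proof. by rewrite /last_subst linext_mono rev_rcons revK. Qed.

Lemma last_subst_letter i : last_subst (letter K i) = f i.
Proof. by rewrite -[letter _ _]/(mono K (rcons [::] i)) last_subst_rcons mul1r. Qed.

Lemma last_substM p q : aug q -> last_subst (p * q) = p * last_subst q.
Proof.
elim/aug_rcons_ind => [|x y Hx Hy|k x Hx|w i].
- by rewrite mulr0 !linear0 mulr0.
- by rewrite mulrDr !linearD /= Hx Hy mulrDr.
- by rewrite -scalerAr !linearZ /= Hx scalerAr.
elim/fa_ind: p => [|x y Hx Hy|k x Hx|v].
- by rewrite !mul0r linear0.
- by rewrite !mulrDl linearD /= Hx Hy.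
- by rewrite -!scalerAl linearZ /= Hx.
by rewrite monoM -rcons_cat !last_subst_rcons mulrA monoM.
Qed.

Lemma aug_last_subst p : (forall i, aug (f i)) -> aug (last_subst p).
Proof.
move=> augf; elim/fa_ind: p => [|x y Hx Hy|k x Hx|w].
- by rewrite linear0; apply: aug0.
- by rewrite linearD; apply: augD.
- by rewrite linearZ; apply: augZ.
case/lastP: w => [|w i]; first by rewrite /last_subst linext_mono; apply: aug0.
by rewrite last_subst_rcons; apply: aug_mull.
Qed.

(** Right multiplication by [x] is left-linear, so lifting it on the letters is enough. *)
Lemma eval_last_subst (U : algType K) (z : 'I_m -> U) x p :
    (forall i, eval z (f i) = z i * x) -> aug p ->
  eval z (last_subst p) = eval z p * x.
Proof.
move=> fx; elim/aug_rcons_ind => [|y y' Hy Hy'|k y Hy|w i].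
- by rewrite !linear0 mul0r.
- by rewrite !linearD /= Hy Hy' mulrDl.
- by rewrite !linearZ /= Hy scalerAl.
by rewrite last_subst_rcons rmorphM /= fx -cats1 -monoM rmorphM /= eval_letter mulrA.
Qed.
End LastSubst.

(** * Right action of the free algebra on a module *)

Section Action.
Variables (K : comNzRingType) (n : nat) (V : lmodType K) (f : 'I_n -> {linear V -> V}).

(** The first letter of a word acts first, which makes this a right action, as needed to imitate
    right multiplication. *)
Definition act (p : freeAlg K n) (v : V) : V :=
  linext (fun w => foldl (fun v x => f x v) v w) p.

Lemma actDl v p q : act (p + q) v = act p v + act q v.
Proof. exact: linearD. Qed.
Lemma actZl v k p : act (k *: p) v = k *: act p v.
Proof. exact: linearZ. Qed.
Lemma act0l v : act 0 v = 0.
Proof. exact: linear0. Qed.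
Lemma act_mono v w : act (mono K w) v = foldl (fun v x => f x v) v w.
Proof. exact: linext_mono. Qed.
Lemma act_letter v i : act (letter K i) v = f i v.
Proof. exact: act_mono. Qed.
Lemma act1 v : act 1 v = v.
Proof. exact: act_mono. Qed.

Lemma act_is_linear p : linear (act p).
Proof.
move=> k v w; elim/fa_ind: p => [|x y Hx Hy|l x Hx|u].
- by rewrite !act0l scaler0 addr0.
- by rewrite !actDl Hx Hy scalerDr addrACA.
- by rewrite !actZl Hx scalerDr !scalerA mulrC.
by rewrite !act_mono; elim: u v w => //= i u IHu v w; rewrite linearP.
Qed.
HB.instance Definition _ p := GRing.isLinear.Build K V V _ (act p) (act_is_linear p).

Lemma actM p q v : act (p * q) v = act q (act p v).
Proof.
elim/fa_ind: p => [|x y Hx Hy|k x Hx|u].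
- by rewrite mul0r act0l linear0.
- by rewrite mulrDl !actDl Hx Hy linearD.
- by rewrite -scalerAl !actZl Hx linearZ.
elim/fa_ind: q => [|x y Hx Hy|k x Hx|w].
- by rewrite mulr0 !act0l.
- by rewrite mulrDr !actDl Hx Hy.
- by rewrite -scalerAr !actZl Hx.
by rewrite monoM !act_mono foldl_cat.
Qed.

Lemma act_invariant (P : V -> Prop) p v : submodule_pred P ->
  (forall i w, P w -> P (f i w)) -> P v -> P (act p v).
Proof.
case=> P0 PD PZ Pf Pv; elim/fa_ind: p => [|x y Hx Hy|k x Hx|w].
- by rewrite act0l.
- by rewrite actDl; apply: PD.
- by rewrite actZl; apply: PZ.
by rewrite act_mono; elim: w v Pv => //= i w IHw v Pv; apply/IHw/Pf.
Qed.
End Action.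

(* The states [(c, p)] stand for the elements [lincomb c s + eval z p] of [U],
   and [step j] for right multiplication by [s j] on them. *)
Section Step.
Variables (K : comNzRingType) (k m : nat).
Variables (st : 'I_k * 'I_k -> 'rV[K]_k * freeAlg K m) (sg : 'I_k * 'I_m -> freeAlg K m).

Definition shift j : freeAlg K m -> freeAlg K m := last_subst (fun i => sg (j, i)).
HB.instance Definition _ j := GRing.Linear.on (shift j).

Definition step j (v : 'rV[K]_k * freeAlg K m) : 'rV[K]_k * freeAlg K m :=
  lincomb v.1 (fun i => st (i, j)) + (0, shift j v.2).

Lemma step_is_linear j : linear (step j).
Proof.
move=> a v w; rewrite /step lincombP scalerDr addrACA /= linearP.
by congr (_ + _); congr pair; rewrite /= scaler0 addr0.
Qed.
HB.instance Definition _ j := GRing.isLinear.Build K _ _ _ (step j) (step_is_linear j).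

Lemma step_inr j q : step j (0, q) = (0, shift j q).
Proof. by rewrite /step lincomb0 add0r. Qed.
End Step.

Lemma lincomb_pair (K : comNzRingType) (V W : lmodType K) k (c : 'rV[K]_k)
    (s : 'I_k -> V) (t : 'I_k -> W) :
  lincomb c (fun i => (s i, t i)) = (lincomb c s, lincomb c t).
Proof.
by rewrite [LHS]surjective_pairing; congr pair;
  [rewrite (linear_lincomb fst) | rewrite (linear_lincomb snd)].
Qed.

(** * Finitely many relations between the generators of a right ideal *)

Section Relations.
Variables (K : comNzRingType) (U : algType K) (L : U -> Prop) (k n m h e : nat).
Variables (s : 'I_k -> U) (a : 'I_n -> U) (z : 'I_m -> U) (io : 'I_n -> 'I_k) (i0 : 'I_k).
Variables (R : seq (freeAlg K n)) (st : 'I_k * 'I_k -> 'rV[K]_k * freeAlg K m).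
Variables (sg : 'I_k * 'I_m -> freeAlg K m) (ph : 'I_m -> freeAlg K n).
Variables (C : 'M[K]_(h, k)) (u : 'I_h -> freeAlg K m) (lam : 'rV[K]_k -> 'rV[K]_h).
Variable (D : 'M[K]_(e, h)).

Local Notation V := ('rV[K]_k * freeAlg K m)%type.
Definition state_val (v : V) : U := lincomb v.1 s + eval z v.2.

Hypotheses (s_io : forall i, s (io i) = a i) (s_i0 : s i0 = 1).
Hypothesis Lz : forall p, aug p -> L (eval z p).
Hypothesis evalR : forall r, r \in R -> eval a r = 0.
Hypotheses (aug_st : forall ij, aug (st ij).2)
  (val_st : forall i j, state_val (st (i, j)) = s i * s j).
Hypotheses (aug_sg : forall ji, aug (sg ji))
  (eval_sg : forall j i, eval z (sg (j, i)) = z i * s j).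
Hypotheses (aug_ph : forall i, aug (ph i)) (eval_ph : forall i, eval a (ph i) = z i).
Hypotheses (aug_u : forall l, aug (u l)) (eval_u : forall l, eval z (u l) = lincomb (row l C) s).
Hypothesis lamP : forall c, L (lincomb c s) -> c = lam c *m C.
Hypothesis DP : forall l : 'rV_h, l *m C = 0 <-> exists d, l = d *m D.
Hypothesis kerR : forall p, aug p -> eval a p = 0 -> ideal (fun r => r \in R) p.

Local Notation rho j := (step st sg j).
Local Notation sig j := (shift sg j).
Local Notation act_state := (act (fun i : 'I_n => (rho (io i) : {linear V -> V}))).
Local Notation act_word :=
  (act (fun i : 'I_n => (sig (io i) : {linear freeAlg K m -> freeAlg K m}))).

Let aug_state (v : V) := aug v.2.

Lemma state_valP b v w : state_val (b *: v + w) = b *: state_val v + state_val w.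
Proof. by rewrite /state_val /= lincombP linearP scalerDr addrACA. Qed.
HB.instance Definition _ := GRing.isLinear.Build K V U _ state_val state_valP.

Lemma state_val_inr p : state_val (0, p) = eval z p.
Proof. by rewrite /state_val lincomb0 add0r. Qed.

Lemma submodule_aug_state : submodule_pred aug_state.
Proof.
by split=> [|v w|b v]; [apply: aug0 | apply: augD | apply: augZ].
Qed.

Lemma aug_shift j q : aug (sig j q).
Proof. by apply: aug_last_subst. Qed.
Lemma eval_shift j q : aug q -> eval z (sig j q) = eval z q * s j.
Proof. by move=> augq; apply: eval_last_subst. Qed.
Lemma shiftM j p q : aug q -> sig j (p * q) = p * sig j q.
Proof. by move=> augq; rewrite /shift last_substM. Qed.
Lemma shift_letter j i : sig j (letter K i) = sg (j, i).
Proof. by rewrite /shift last_subst_letter. Qed.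

Lemma aug_step j v : aug_state (rho j v).
Proof.
have [_ augD' _] := submodule_aug_state; apply: augD'; last exact: aug_shift.
by apply: (submodule_lincomb _ submodule_aug_state) => i; apply: aug_st.
Qed.

Lemma val_step j v : aug_state v -> state_val (rho j v) = state_val v * s j.
Proof.
move=> augv; rewrite linearD /= state_val_inr eval_shift // mulrDl; congr (_ + _).
rewrite linear_lincomb mulr_suml; apply: eq_bigr => i _.
by rewrite /= val_st scalerAl.
Qed.

Lemma aug_act p v : aug_state v -> aug_state (act_state p v).
Proof. by apply: (act_invariant _ submodule_aug_state) => i w _; apply: aug_step. Qed.

Lemma val_act p v : aug_state v -> state_val (act_state p v) = state_val v * eval a p.
Proof.
elim/fa_ind: p v => [|x y Hx Hy|b x Hx|w] v augv.
- by rewrite act0l !linear0 mulr0.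
- by rewrite actDl !linearD /= Hx // Hy // mulrDr.
- by rewrite actZl !linearZ /= Hx // scalerAr.
elim: w v augv => [|i w IHw] v augv; first by rewrite mono_nil act1 rmorph1 mulr1.
rewrite -cat1s -monoM actM act_letter IHw; last exact: aug_step.
by rewrite val_step // rmorphM /= eval_letter s_io mulrA.
Qed.

Lemma act_state_inr p q : act_state p (0, q) = (0, act_word p q).
Proof.
elim/fa_ind: p => [|x y Hx Hy|b x Hx|w].
- by rewrite !act0l.
- by rewrite !actDl Hx Hy; congr pair; rewrite /= addr0.
- by rewrite !actZl Hx; congr pair; rewrite /= scaler0.
by rewrite !act_mono; elim: w q => //= i w IHw q; rewrite step_inr IHw.
Qed.

Lemma aug_act_word p q : aug q -> aug (act_word p q).
Proof.
by apply: (act_invariant _ (submodule_aug K m)) => i w _; apply: aug_shift.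
Qed.

Lemma eval_act_word p q : aug q -> eval z (act_word p q) = eval z q * eval a p.
Proof.
by move=> augq; rewrite -[LHS]state_val_inr -act_state_inr val_act // state_val_inr.
Qed.

(** This follows from the left-linearity of the shifts. It makes the action on a word ending in
    letter [i] depend only on the action on that letter, so finitely many relations can control
    it. *)
Lemma act_wordM p b q : aug q -> act_word p (b * q) = b * act_word p q.
Proof.
move=> augq; elim/fa_ind: p => [|x y Hx Hy|c x Hx|w].
- by rewrite !act0l mulr0.
- by rewrite !actDl Hx Hy mulrDr.
- by rewrite !actZl Hx scalerAr.
rewrite !act_mono; elim: w q augq => //= i w IHw q augq.
by rewrite shiftM // IHw //; apply: aug_shift.
Qed.

(* The coefficients of a state of value 0 form a combination of the rows of [C], and
   the row [l] of [C] stands for the polynomial [u l]: this trades the coefficients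
   for a polynomial that vanishes in [L]. *)
Definition residue (v : V) : freeAlg K m := v.2 + lincomb (lam v.1) u.

Lemma aug_lincomb_u l : aug (lincomb l u).
Proof. exact: submodule_lincomb (submodule_aug _ _) _. Qed.

Lemma eval_lincomb_u l : eval z (lincomb l u) = lincomb (l *m C) s.
Proof. by rewrite linear_lincomb lincomb_mulmx; apply: eq_lincomb => i /=. Qed.

Lemma state_val0 v : aug_state v -> state_val v = 0 -> v.1 = lam v.1 *m C.
Proof.
move=> augv v0; apply: lamP.
have -> : lincomb v.1 s = eval z (- v.2); last by apply/Lz/augN.
by apply/eqP; rewrite linearN /= -addr_eq0; apply/eqP.
Qed.

Lemma eval_residue v : aug_state v -> state_val v = 0 -> eval z (residue v) = 0.
Proof.
by move=> augv v0; rewrite linearD /= eval_lincomb_u -state_val0 // addrC.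
Qed.

Lemma aug_residue v : aug_state v -> aug (residue v).
Proof. by move=> augv; apply: augD => //; apply: aug_lincomb_u. Qed.

Definition start : V := (delta_mx 0 i0, 0).
Let basis i : V := (delta_mx 0 i, 0).

(* In this order: multiplying by [s i] and then by [s j] agrees with multiplying by
   [s i * s j]; [step] preserves the null states [(row l C, - u l)]; the relators of
   the ambient algebra kill the states [(e_i, 0)] and [(0, z_i)]; lifting [z_i] to
   the ambient algebra and acting on the state of 1, resp. of [z_j], gives back
   [z_i], resp. [z_j z_i]; the syzygies [D] of the rows of [C] hold for the [u l]. *)
Definition basic_relation (q : freeAlg K m) : Prop :=
  (exists t, q = sig t.2 (sg (t.1.2, t.1.1)) -
     (lincomb (st (t.1.2, t.2)).1 (fun l => sg (l, t.1.1)) +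
      letter K t.1.1 * (st (t.1.2, t.2)).2)) \/
  (exists jl, q = residue (rho jl.1 (row jl.2 C, - u jl.2))) \/
  (exists2 r, r \in R & exists i, q = residue (act_state r (basis i))) \/
  (exists2 r, r \in R & exists i, q = act_word r (letter K i)) \/
  (exists i, q = residue (act_state (ph i) start - (0, letter K i))) \/
  (exists ij, q = act_word (ph ij.1) (letter K ij.2) - letter K ij.2 * letter K ij.1) \/
  (exists d, q = lincomb (row d D) u).

(* One application of the shifts suffices to get an ideal stable under them, since
   [sig j (sig i q)] is a combination of the [sig l q] and of a multiple of [q]
   modulo the first family of basic relations. *)
Definition relation (q : freeAlg K m) : Prop :=
  basic_relation q \/ exists j, exists2 p, basic_relation p & q = sig j p.

Lemma finite_basic_relation : finite_pred basic_relation.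
Proof.
apply: finite_pred_or; first by apply: finite_pred_ex => i; apply: finite_pred_eq.
apply: finite_pred_or; first by apply: finite_pred_ex => i; apply: finite_pred_eq.
do 2![apply: finite_pred_or;
  first by apply: finite_pred_bigex => r; apply: finite_pred_ex => i; apply: finite_pred_eq].
do 2![apply: finite_pred_or; first by apply: finite_pred_ex => i; apply: finite_pred_eq].
by apply: finite_pred_ex => i; apply: finite_pred_eq.
Qed.

Lemma finite_relation : finite_pred relation.
Proof.
have [Q QP] := finite_basic_relation; apply: finite_pred_or; first by exists Q.
apply: finite_pred_ex => j.
have [Q' Q'P] := finite_pred_bigex Q (fun p => finite_pred_eq (sig j p)).
by exists Q' => q; rewrite -Q'P; split=> -[p /QP]; exists p.
Qed.

Lemma basic_relation_sound q : basic_relation q -> aug q /\ eval z q = 0.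
Proof.
have residueP v : aug_state v -> state_val v = 0 ->
    aug (residue v) /\ eval z (residue v) = 0.
  by move=> augv v0; split; [apply: aug_residue | apply: eval_residue].
have start0 i : aug_state (basis i) by apply: aug0.
have val_basis i : state_val (basis i) = s i.
  by rewrite /state_val /= lincomb_delta linear0 addr0.
have augl i : aug (letter K i : freeAlg K m) by apply: aug_letter.
case=> [[[[i j] l] ->]|[[[j l] ->]|[[r rR [i ->]]|[[r rR [i ->]]|[[i ->]|[[[i j] ->]|[d ->]]]]]]] /=.
- split.
    apply: augB; [exact: aug_shift | apply: augD; last exact: aug_mulr].
    by apply: submodule_lincomb (submodule_aug _ _) _.
  (* Both sides evaluate to [z i * s j * s l]. *)
  rewrite linearB linearD /= eval_shift // rmorphM /= eval_letter eval_sg -mulrA -val_st.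
  rewrite mulrDr linear_lincomb [lincomb _ s]/lincomb mulr_sumr -[X in _ - (X + _)]/(\sum_i _).
  rewrite (eq_bigr (fun i1 => (st (j, l)).1 0 i1 *: (eval z \o (fun l0 => sg (l0, i))) i1)).
    by rewrite subrr.
  by move=> i1 _; rewrite /= eval_sg scalerAr.
- apply: residueP; first exact: aug_step.
  have augu : aug_state (row l C, - u l) by apply: augN.
  by rewrite val_step // /state_val /= linearN /= eval_u subrr mul0r.
- apply: residueP; first exact: aug_act.
  by rewrite val_act // evalR // mulr0.
- split; first exact: aug_act_word.
  by rewrite eval_act_word // evalR // mulr0.
- apply: residueP.
    by have := augB (aug_act (ph i) (start0 i0)) (augl i).
  rewrite linearB /= val_act; last exact: aug0.
  by rewrite val_basis s_i0 mul1r eval_ph state_val_inr eval_letter subrr.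
- split; first by apply: augB; [apply: aug_act_word | apply: aug_mull].
  by rewrite linearB rmorphM /= eval_act_word // eval_ph !eval_letter subrr.
split; first exact: aug_lincomb_u.
rewrite eval_lincomb_u (DP (row d D)).2 ?lincomb0 //.
by exists (delta_mx 0 d); rewrite -rowE.
Qed.

Lemma relation_sound q : relation q -> aug q /\ eval z q = 0.
Proof.
case=> [|[j [p /basic_relation_sound[augp p0] ->]]]; first exact: basic_relation_sound.
by split; [apply: aug_shift | rewrite eval_shift // p0 mul0r].
Qed.

Local Notation Id := (ideal relation).

Lemma basic_ideal q : basic_relation q -> Id q.
Proof. by move=> ?; apply: ideal_gen; left. Qed.

(** Both sides are left-linear in [q], so it is enough to treat a letter, where this is the first
    family of basic relations. *)
Lemma shift_shift i j q : aug q ->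
  Id (sig j (sig i q) - (lincomb (st (i, j)).1 (fun l => sig l q) + q * (st (i, j)).2)).
Proof.
elim/aug_rcons_ind => [|x y Hx Hy|b x Hx|w l].
- rewrite !linear0 mul0r addr0 sub0r /lincomb big1; first by apply/idealN/ideal0.
  by move=> l _; rewrite linear0 scaler0.
- rewrite [sig i _]linearD [sig j _]linearD /= mulrDl (_ : lincomb _ _ = lincomb (st (i, j)).1 (fun l => sig l x)
    + lincomb (st (i, j)).1 (fun l => sig l y)).
    by rewrite [X in _ - X]addrACA opprD addrACA; apply: idealD.
  by rewrite /lincomb -big_split; apply: eq_bigr => l _; rewrite linearD scalerDr.
- rewrite [sig i _]linearZ [sig j _]linearZ /= -scalerAl (_ : lincomb _ _ = b *: lincomb (st (i, j)).1 (fun l => sig l x)).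
    by rewrite -scalerDr -scalerBr; apply: idealZ.
  rewrite /lincomb scaler_sumr; apply: eq_bigr => l _.
  by rewrite linearZ /= !scalerA mulrC.
rewrite -cats1 -monoM -[mono K [:: l]]/(letter K l) shiftM; last exact: aug_letter.
rewrite shiftM; last exact: aug_shift.
rewrite (_ : lincomb _ _ = mono K w * lincomb (st (i, j)).1 (fun l' => sg (l', l))).
  rewrite -mulrA -mulrDr -mulrBr; apply/ideal_mull/basic_ideal; left.
  by exists (l, i, j); rewrite shift_letter.
rewrite /lincomb mulr_sumr; apply: eq_bigr => l' _.
by rewrite shiftM ?shift_letter ?scalerAr //; apply: aug_letter.
Qed.

(** The induction also carries [aug], without which the shifts are not left-linear. *)
Lemma shift_ideal j q : Id q -> Id (sig j q).
Proof.
suff /[apply] : Id q -> [/\ Id q, aug q & forall j, Id (sig j q)] by case.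
elim=> [g Gg||x y _ [Ix ax Sx] _ [Iy ay Sy]|b x _ [Ix ax Sx]|x b _ [Ix ax Sx]] {q j}.
- have [augg _] := relation_sound Gg; split=> // [|j]; first exact: ideal_gen.
  (* The shift of a basic relation is a generator by definition; for a relation already shifted,
     [shift_shift] reduces two shifts to one. *)
  case: Gg => [Bg|[i [p Bp ->]]]; first by apply: ideal_gen; right; exists j; exists g.
  have [augp _] := basic_relation_sound Bp; apply: (ideal_trans (shift_shift i j augp)).
  apply: idealD; last by apply/ideal_mulr/basic_ideal.
  apply: ideal_sum => l _; apply/idealZ/ideal_gen; right; by exists l; exists p.
- by split=> [||j]; [apply: ideal0 | apply: aug0 | rewrite linear0; apply: ideal0].
- by split=> [||j]; [apply: idealD | apply: augD | rewrite linearD /=; apply: idealD].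
- by split=> [||j]; [apply: ideal_mull | apply: aug_mull | rewrite shiftM //; apply: ideal_mull].
split=> [||j]; [exact: ideal_mulr | exact: aug_mulr |].
(* A nonempty word [b] gives [x * sig j b], in the ideal because [x] is; the empty word gives
   [sig j x]. *)
elim/fa_ind: b => [|c d Hc Hd|c b Hb|w].
- by rewrite mulr0 linear0; apply: ideal0.
- by rewrite mulrDr linearD; apply: idealD.
- by rewrite -scalerAr linearZ; apply: idealZ.
case: w => [|i w]; first by rewrite mulr1.
by rewrite shiftM; [apply: ideal_mulr | apply: aug_cons].
Qed.

(** The coordinates [l] are quantified rather than set to [lam v.1]: [lam] is an arbitrary choice,
    not known to be linear, and null states must form a submodule. *)
Definition null (v : V) : Prop := exists l, v.1 = l *m C /\ Id (v.2 + lincomb l u).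

Lemma submodule_null : submodule_pred null.
Proof.
split=> [|v w [l [vl Iv]] [l' [wl Iw]]|b v [l [vl Iv]]].
- by exists 0; rewrite mul0mx lincomb0 addr0; split=> //; apply: ideal0.
- exists (l + l'); rewrite /= vl wl mulmxDl lincombD addrACA; split=> //.
  exact: idealD.
- exists (b *: l); rewrite /= vl -scalemxAl lincombZ -scalerDr; split=> //.
  exact: idealZ.
Qed.

Lemma null_residue v : aug_state v -> state_val v = 0 -> Id (residue v) -> null v.
Proof. by move=> augv v0 Iv; exists (lam v.1); split=> //; apply: state_val0. Qed.

Lemma null_inr q : Id q -> null (0, q).
Proof. by move=> Iq; exists 0; rewrite mul0mx lincomb0 addr0. Qed.

(** The hidden [l] satisfies [l *m C = 0], so it is a combination of the rows of [D], and the last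
    family of relations puts [lincomb l u] in the ideal. *)
Lemma ideal_null q : null (0, q) -> Id q.
Proof.
case=> l [/= /esym/DP[d ->]]; rewrite lincomb_mulmx => Iq.
rewrite -[q](addrK (lincomb d (fun i => lincomb (row i D) u))); apply: idealB => //.
apply: ideal_sum => i _; apply/idealZ/basic_ideal; do 6!right; by exists i.
Qed.

Lemma null_step j v : null v -> null (rho j v).
Proof.
have [N0 ND NZ] := submodule_null.
(* A null state is a combination of the states [(row i C, - u i)], handled by the second family,
   plus some [(0, q)] with [q] in the ideal, handled by [shift_ideal]. *)
case=> l [vl Iv]; have -> : v = lincomb l (fun i => (row i C, - u i)) + (0, v.2 + lincomb l u).
  rewrite lincomb_pair [v in LHS]surjective_pairing; congr pair => /=.
    by rewrite addr0 vl mulmx_sum_row.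
  by rewrite addrCA /lincomb -big_split big1 ?addr0 // => i _; rewrite /= scalerN addNr.
rewrite linearD /= step_inr; apply: (ND); last exact/null_inr/shift_ideal.
rewrite linear_lincomb; apply: (submodule_lincomb _ submodule_null) => i /=.
have augu : aug_state (row i C, - u i) by apply: augN.
apply: null_residue; first exact: aug_step.
  by rewrite val_step // /state_val /= linearN /= eval_u subrr mul0r.
by apply: basic_ideal; right; left; exists (j, i).
Qed.

Lemma null_act p v : null v -> null (act_state p v).
Proof. by apply: (act_invariant _ submodule_null) => i w; apply: null_step. Qed.

(** Linearity reduces the coefficients to basis vectors, and left-linearity reduces the polynomial
    to letters; the third and fourth families treat these cases. *)
Lemma null_act_relator r v : r \in R -> aug_state v -> null (act_state r v).
Proof.
have [N0 ND NZ] := submodule_null.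
move=> rR augv; have -> : v = lincomb v.1 basis + (0, v.2).
  rewrite lincomb_pair [v in LHS]surjective_pairing; congr pair => /=.
    by rewrite addr0 [LHS]row_sum_delta.
  by rewrite /lincomb big1 ?add0r // => i _; rewrite scaler0.
rewrite linearD /= act_state_inr; apply: (ND).
  rewrite linear_lincomb; apply: (submodule_lincomb _ submodule_null) => i /=.
  have aug_b : aug_state (basis i) by apply: aug0.
  apply: null_residue; [exact: aug_act | by rewrite val_act // evalR // mulr0 |].
  by apply: basic_ideal; do 2!right; left; exists r => //; exists i.
apply: null_inr; elim/aug_rcons_ind: augv => [|x y Hx Hy|b x Hx|w i].
- by rewrite linear0; apply: ideal0.
- by rewrite linearD; apply: idealD.
- by rewrite linearZ; apply: idealZ.
rewrite -cats1 -monoM act_wordM; last exact: aug_letter.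
apply/ideal_mull/basic_ideal; do 3!right; left; exists r => //; by exists i.
Qed.

Lemma null_act_ideal p v :
  ideal (fun r => r \in R) p -> aug_state v -> null (act_state p v).
Proof.
have [N0 ND NZ] := submodule_null.
(* The state stays general: a left multiplier acts first and changes it, while a right multiplier
   acts last and preserves null states. *)
move=> Rp; elim: Rp v => [r rR||x y _ Hx _ Hy|b x _ Hx|x b _ Hx] v augv.
- exact: null_act_relator.
- by rewrite act0l.
- by rewrite actDl; apply: ND; [apply: Hx | apply: Hy].
- by rewrite actM; apply/Hx/aug_act.
- by rewrite actM; apply/null_act/Hx.
Qed.

(** Induction on the last letter: [null_act] carries the shorter word through one more action of
    [ph i], which on polynomial states is right multiplication by letter [i] modulo the sixth
    family. *)
Lemma null_lift q : aug q -> null (act_state (eval ph q) start - (0, q)).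
Proof.
have [N0 ND NZ] := submodule_null.
have pairD (x y : freeAlg K m) : (0, x + y) = (0, x) + (0, y) :> V.
  by congr pair; rewrite /= addr0.
have pairZ b (x : freeAlg K m) : (0, b *: x) = b *: (0, x) :> V.
  by congr pair; rewrite /= scaler0.
elim/aug_rcons_ind => [|x y Hx Hy|b x Hx|w i].
- by rewrite linear0 act0l subr0.
- by rewrite linearD actDl pairD opprD addrACA; apply: ND.
- by rewrite linearZ actZl pairZ -scalerBr; apply: NZ.
have base j : null (act_state (ph j) start - (0, letter K j)).
  apply: null_residue.
  - have aug_s : aug_state start by apply: aug0.
    by have := augB (aug_act (ph j) aug_s) (aug_letter K j).
  - have aug_s : aug_state start by apply: aug0.
    rewrite linearB /= val_act // state_val_inr eval_ph eval_letter /state_val /=.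
    by rewrite lincomb_delta s_i0 linear0 addr0 mul1r subrr.
  by apply: basic_ideal; do 4!right; left; exists j.
elim/last_ind: w i => [|w j IHw] i; first by rewrite -[mono _ _]/(letter K i) eval_letter.
rewrite -cats1 -monoM rmorphM /= -[mono K [:: i]]/(letter K i) eval_letter actM.
rewrite -[act_state _ start](subrK (0, mono K (rcons w j))) linearD /= -addrA.
apply: (ND); first exact/null_act/IHw.
rewrite act_state_inr.
have -> : (0, act_word (ph i) (mono K (rcons w j))) - (0, mono K (rcons w j) * letter K i)
    = (0, mono K w * (act_word (ph i) (letter K j) - letter K j * letter K i)) :> V.
  rewrite mulrBr mulrA -act_wordM; last exact: aug_letter.
  rewrite [mono K w * letter K j]monoM cats1.
  by congr pair; rewrite //= subr0.
apply/null_inr/ideal_mull/basic_ideal; do 5!right; left; by exists (i, j).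
Qed.

Theorem relation_complete q : aug q -> eval z q = 0 -> Id q.
Proof.
move=> augq q0; apply: ideal_null; have [N0 ND NZ] := submodule_null.
have Rq : ideal (fun r => r \in R) (eval ph q).
  apply: kerR; first exact: aug_eval.
  have ez : (fun i => eval a (ph i)) =1 z by [].
  by rewrite eval_comp (eval_ext ez).
have start_aug : aug_state start by apply: aug0.
(* [(0, q)] is a state null because [eval ph q] is a relation of the ambient algebra, minus a state
   null by [null_lift]. *)
rewrite -[(0, q)](subKr (act_state (eval ph q) start)); apply: (ND).
  exact: null_act_ideal.
by rewrite -scaleN1r; apply/NZ/null_lift.
Qed.
End Relations.

Lemma lincomb_lincomb (K : comNzRingType) (V : lmodType K) h k (l : 'rV[K]_h)
    (f : 'I_h -> 'rV_k) (s : 'I_k -> V) :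
  lincomb (lincomb l f) s = lincomb l (fun i => lincomb (f i) s).
Proof.
rewrite [lincomb l f]/lincomb (big_morph (fun c => lincomb c s) (lincombD s) (lincomb0 s)).
by apply: eq_bigr => i _; rewrite lincombZ.
Qed.

(** * Generators and presentation of a right ideal *)

Section RightIdeal.
Variables (K : comNzRingType) (U : algType K) (L : U -> Prop) (k n : nat).
Variables (s : 'I_k -> U) (a : 'I_n -> U) (io : 'I_n -> 'I_k) (i0 : 'I_k).
Hypotheses (noethK : noetherian K) (modL : submodule_pred L).
Hypotheses (s_io : forall i, s (io i) = a i) (s_i0 : s i0 = 1).
Hypothesis genL : forall x, L x -> exists p, aug p /\ eval a p = x.
Hypothesis idealL : forall x j, L x -> L (x * s j).
Hypothesis span_s : forall i j, exists c t, L t /\ s i * s j = lincomb c s + t.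

Lemma right_ideal_eval x p : L x -> L (x * eval a p).
Proof.
have [L0 LD LZ] := modL; move=> Lx.
elim/fa_ind: p => [|y y' Hy Hy'|b y Hy|w].
- by rewrite linear0 mulr0.
- by rewrite linearD mulrDr; apply: LD.
- by rewrite linearZ -scalerAr; apply: LZ.
elim/last_ind: w => [|w i IHw]; first by rewrite mono_nil rmorph1 mulr1.
by rewrite -cats1 -monoM rmorphM /= eval_letter mulrA -s_io; apply: idealL.
Qed.

Lemma right_ideal_subalgebra : subalgebra_pred L.
Proof. by split=> // x y Lx /genL[p [_ <-]]; apply: right_ideal_eval. Qed.

(** The parts in [L] of the products [s i * s j], with generators of the combinations of [s] lying
    in [L], form a finite family [y]. The products [y i * s j] generate a subalgebra [G] stable
    under right multiplication by [s], and every [eval a p] is a combination of [s] plus an element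
    of [G]. *)
Lemma right_ideal_fin_gen : exists m (z : 'I_m -> U),
  (forall i, L (z i)) /\ forall x, L x -> exists p, aug p /\ eval z p = x.
Proof.
have [L0 LD LZ] := modL.
have /boolp.choice[ct ctP] (ij : 'I_k * 'I_k) :
    exists ct, L ct.2 /\ s ij.1 * s ij.2 = lincomb ct.1 s + ct.2.
  by have [c [t ct]] := span_s ij.1 ij.2; exists (c, t).
have [h [C CP]] := noetherian_rV noethK (submodule_comb s modL).
pose y (i : 'I_k * 'I_k + 'I_h) :=
  match i with inl ij => (ct ij).2 | inr l => lincomb (row l C) s end.
have Ly i : L (y i).
  case: i => [ij|l]; first by have [] := ctP ij.
  by apply/CP; exists (delta_mx 0 l); rewrite -rowE.
pose T : finType := (('I_k * 'I_k + 'I_h) * 'I_k)%type.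
pose z (i : 'I_#|T|) := y (enum_val i).1 * s (enum_val i).2.
pose lt (i : 'I_k * 'I_k + 'I_h) (j : 'I_k) : freeAlg K #|T| := letter K (enum_rank ((i, j) : T)).
have z_lt i j : eval z (lt i j) = y i * s j by rewrite eval_letter /z enum_rankK.
have y_lt i : eval z (lt i i0) = y i by rewrite z_lt s_i0 mulr1.
have aug_lt i j : aug (lt i j) by apply: aug_letter.
pose G x := exists p, aug p /\ eval z p = x.
have GD x x' : G x -> G x' -> G (x + x').
  by move=> [p [ap <-]] [q [aq <-]]; exists (p + q); rewrite linearD; split=> //; apply: augD.
have GZ b x : G x -> G (b *: x).
  by move=> [p [ap <-]]; exists (b *: p); rewrite linearZ; split=> //; apply: augZ.
have G0 : G 0 by exists 0; rewrite linear0; split=> //; apply: aug0.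
have modG : submodule_pred G by split.
have Gy i : G (y i) by exists (lt i i0).
have Gt ij : G (ct ij).2 by apply: (Gy (inl ij)).
have Gs x j : G x -> G (x * s j).
  case=> p [augp <-]; elim/aug_rcons_ind: augp => [|q q' Hq Hq'|b q Hq|w i].
  - by rewrite linear0 mul0r.
  - by rewrite linearD mulrDl; apply: GD.
  - by rewrite linearZ -scalerAl; apply: GZ.
  rewrite -cats1 -monoM rmorphM /= eval_letter /z; case: (enum_val i) => f l /=.
  (* Expanding [s l * s j], the combination part gives generators [y f * s i'] again, and the part
     in [L] is itself some [y], hence a generator since [s i0 = 1]. *)
  have [_ e] := ctP (l, j); rewrite -!mulrA e !mulrDr; apply/GD.
    rewrite !mulr_sumr; apply: (big_ind G) => // i' _; rewrite -!scalerAr; apply: GZ.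
    by exists (mono K w * lt f i'); rewrite rmorphM /= z_lt; split=> //; apply: aug_mull.
  exists (mono K w * (lt f i0 * lt (inl (l, j)) i0)); rewrite !rmorphM /= !y_lt.
  by split=> //; do 2!apply: aug_mull.
have normal p : exists c g, G g /\ eval a p = lincomb c s + g.
  elim/fa_ind: p => [|x x' [c [g [Gg e]]] [c' [g' [Gg' e']]]|b x [c [g [Gg e]]]|w].
  - by exists 0, 0; rewrite linear0 lincomb0 addr0.
  - exists (c + c'), (g + g'); split; first exact: GD.
    by rewrite linearD /= e e' lincombD addrACA.
  - by exists (b *: c), (b *: g); rewrite linearZ /= e lincombZ scalerDr; split=> //; apply: GZ.
  elim/last_ind: w => [|w i [c [g [Gg e]]]].
    by exists (delta_mx 0 i0), 0; rewrite mono_nil rmorph1 lincomb_delta addr0.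
  exists (lincomb c (fun l => (ct (l, io i)).1)), (lincomb c (fun l => (ct (l, io i)).2) + g * s (io i)).
  split; first by apply: GD; [apply: submodule_lincomb | apply: Gs].
  rewrite -cats1 -monoM rmorphM /= e eval_letter -s_io mulrDl addrA; congr (_ + _).
  rewrite lincomb_lincomb mulr_suml -big_split; apply: eq_bigr => l _ /=.
  by have [_ /= e'] := ctP (l, io i); rewrite -scalerAl e' scalerDr.
have LG x : G x -> L x.
  move=> [p [augp <-]]; apply: subalgebra_eval augp => //.
    exact: right_ideal_subalgebra.
  by move=> i; apply: idealL.
exists #|T|, z; split=> [i|x Lx]; first exact: idealL.
have [p [_ xp]] := genL Lx; have [c [g [Gg e]]] := normal p.
(* [lincomb c s] is the difference of [x] and [g], both in [L], so [c] is in the row space of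
   [C]. *)
have [|l cl] := (CP c).1.
  rewrite -[lincomb c s](addrK g) -e xp -scaleN1r.
  by apply: LD => //; apply/LZ/LG.
rewrite -[exists p, _]/(G x) -xp e; apply: (GD) => //.
rewrite cl lincomb_mulmx; apply: (submodule_lincomb _ modG) => i; exact: (Gy (inr i)).
Qed.

Lemma right_ideal_fp (R : seq (freeAlg K n)) :
    (forall r, r \in R -> aug r) ->
    (forall p, aug p -> eval a p = 0 <-> ideal (fun r => r \in R) p) ->
  alg_fp L.
Proof.
move=> augR kerR; have [m [z [Lz surjz]]] := right_ideal_fin_gen.
have [h [C CP]] := noetherian_rV noethK (submodule_comb s modL).
have [|e [D DP]] := noetherian_rV (P := fun l : 'rV_h => l *m C = 0) noethK.
  split=> [|l l' Hl Hl'|b l Hl]; first exact: mul0mx.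
    by rewrite mulmxDl Hl Hl' addr0.
  by rewrite -scalemxAl Hl scaler0.
(* When the combination is not in [L], [lam] takes the default value [0]. *)
have /boolp.choice[lam lamP] (c : 'rV_k) : exists l, L (lincomb c s) -> c = l *m C.
  have [/CP[l cl]|nc] := boolp.EM (L (lincomb c s)); first by exists l.
  by exists 0 => /nc.
have /boolp.choice[u uP] (l : 'I_h) : exists p, aug p /\ eval z p = lincomb (row l C) s.
  by apply/surjz/CP; exists (delta_mx 0 l); rewrite -rowE.
have /boolp.choice[st stP] (ij : 'I_k * 'I_k) : exists cp : 'rV_k * freeAlg K m,
    aug cp.2 /\ lincomb cp.1 s + eval z cp.2 = s ij.1 * s ij.2.
  have [c [t [/surjz[p [augp pt]] e']]] := span_s ij.1 ij.2.
  by exists (c, p); rewrite e' -pt.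
have /boolp.choice[sg sgP] (ji : 'I_k * 'I_m) :
    exists p, aug p /\ eval z p = z ji.2 * s ji.1.
  exact/surjz/idealL.
have /boolp.choice[ph phP] i : exists p, aug p /\ eval a p = z i by apply: genL.
have Leval p : aug p -> L (eval z p).
  by apply: subalgebra_eval => //; apply: right_ideal_subalgebra.
pose rel := relation io i0 R st sg ph C u lam D.
have evalR r : r \in R -> eval a r = 0.
  by move=> rR; apply/kerR; [apply: augR | apply: ideal_gen].
have [Q QP] : finite_pred rel by apply: finite_relation.
have aug_st ij : aug (st ij).2 by have [] := stP ij.
have val_st i j : state_val s z (st (i, j)) = s i * s j by have [] := stP (i, j).
have aug_sg ji : aug (sg ji) by have [] := sgP ji.
have eval_sg j i : eval z (sg (j, i)) = z i * s j by have [] := sgP (j, i).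
have aug_ph i : aug (ph i) by have [] := phP i.
have eval_ph i : eval a (ph i) = z i by have [] := phP i.
have aug_u l : aug (u l) by have [] := uP l.
have eval_u l : eval z (u l) = lincomb (row l C) s by have [] := uP l.
have sound q : rel q -> aug q /\ eval z q = 0.
  exact: (relation_sound s_io s_i0 Leval evalR aug_st val_st aug_sg eval_sg
    eval_ph aug_u eval_u lamP DP).
exists m, z, Q; split=> //.
  by move=> q /QP/sound[].
move=> p augp; split=> [p0|]; last first.
  by apply: (ideal_kernel (f := eval z)) => q /QP/sound[].
apply: (ideal_sub (G := rel)) => [q /QP|]; first exact: ideal_gen.
have kerR' q : aug q -> eval a q = 0 -> ideal (fun r => r \in R) q by move=> /kerR->.
exact: (relation_complete s_io s_i0 Leval evalR aug_st val_st aug_sg eval_sg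
  aug_ph eval_ph aug_u eval_u lamP DP kerR').
Qed.

End RightIdeal.

(** * The conductor and the equivalence inside a unital algebra *)

Section RightIdealOf.
Variables (K : comNzRingType) (U : algType K) (S : U -> Prop).
Hypotheses (noethK : noetherian K) (subS : subalgebra_pred S).

(** [right_ideal_fp] wants [1] and the generators of [S] among the spanning elements, so they are
    put in front of [s0]; since [1] may lie outside [S], products with it are treated apart. *)
Lemma alg_fp_right_ideal (L : U -> Prop) k0 (s0 : 'I_k0 -> U) :
    submodule_pred L -> (forall x, L x -> S x) -> (forall x y, L x -> S y -> L (x * y)) ->
    (forall i, S (s0 i)) -> (forall x, S x -> exists c t, L t /\ x = lincomb c s0 + t) ->
  alg_fp S -> alg_fp L.
Proof.
move=> modL LS idealL Ss0 span [n [a [R [Sa augR surj ker]]]].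
have [L0 _ _] := modL; have [_ SM] := subS.
pose s (i : 'I_(1 + (n + k0))) :=
  match split i with
  | inl _ => 1
  | inr j => match split j with inl x => a x | inr l => s0 l end
  end.
pose i0 : 'I_(1 + (n + k0)) := lshift _ ord0.
pose io i : 'I_(1 + (n + k0)) := rshift 1 (lshift k0 i).
pose is0 i : 'I_(1 + (n + k0)) := rshift 1 (rshift n i).
have s_i0 : s i0 = 1 by rewrite /s -[i0]/(unsplit (inl ord0)) unsplitK.
have s_io i : s (io i) = a i.
  rewrite /s -[io i]/(unsplit (inr _)) unsplitK.
  by rewrite -[lshift _ _]/(unsplit (inl _)) unsplitK.
have s_is0 i : s (is0 i) = s0 i.
  rewrite /s -[is0 i]/(unsplit (inr _)) unsplitK.
  by rewrite -[rshift _ _]/(unsplit (inr _)) unsplitK.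
have s_case i : s i = 1 \/ S (s i).
  by rewrite /s; case: split => [_|j]; [left | right; case: split].
have span_s i : exists c t, L t /\ s i = lincomb c s + t.
  by exists (delta_mx 0 i), 0; rewrite lincomb_delta addr0.
apply: (right_ideal_fp noethK modL s_io s_i0 _ _ _ augR ker).
- by move=> x /LS/surj.
- by move=> x j Lx; case: (s_case j) => [->|Sj]; rewrite ?mulr1 //; apply: idealL.
move=> i j; have [->|Si] := s_case i; first by rewrite mul1r.
have [->|Sj] := s_case j; first by rewrite mulr1.
have [c [t [Lt e]]] := span _ (SM _ _ Si Sj).
exists (row_mx 0 (row_mx 0 c)), t; split=> //; rewrite e; congr (_ + _).
rewrite !lincomb_row_mx !lincomb0 !add0r; apply: eq_lincomb => l.
by rewrite -s_is0.
Qed.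

(* The kernel of the action of [B] by left multiplication on the K-module [S/B]. *)
Definition conductor (B : U -> Prop) x := B x /\ forall y, S y -> B (x * y).

Variables (B : U -> Prop) (k : nat) (s : 'I_k -> U).
Hypotheses (subB : subalgebra_pred B) (BS : forall x, B x -> S x) (Ss : forall i, S (s i)).
Hypothesis span : forall x, S x -> exists c t, B t /\ x = lincomb c s + t.

Lemma submodule_conductor : submodule_pred (conductor B).
Proof.
have [[B0 BD BZ] BM] := subB.
split=> [|x y [Bx Bx'] [By By']|b x [Bx Bx']].
- by split=> // y Sy; rewrite mul0r.
- by split=> [|z Sz]; [apply: BD | rewrite mulrDl; apply: BD; auto].
- by split=> [|z Sz]; [apply: BZ | rewrite -scalerAl; apply: BZ; auto].
Qed.

Lemma conductor_right_ideal x y : conductor B x -> S y -> conductor B (x * y).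
Proof.
case=> Bx Bx' Sy; have [_ SM] := subS; split=> [|y' Sy']; first exact: Bx'.
by rewrite -mulrA; apply/Bx'/SM.
Qed.

(** Left multiplication by [x] on [S] modulo [B] is given by a matrix of size [k]. The matrices
    arising from [B] form a submodule of [K^(k * k)], finitely generated; the [b i] realize its
    generators. *)
Lemma conductor_span : exists h (b : 'I_h -> U), (forall i, B (b i)) /\
  forall x, B x -> exists c t, conductor B t /\ x = lincomb c b + t.
Proof.
have [modB BM] := subB; have [B0 BD BZ] := modB; have [_ SM] := subS.
(* [v] is a flattened matrix of left multiplication by [x]; [s] need not be independent modulo [B],
   so [x] may have several. *)
pose rel (v : 'rV_(k * k)) x :=
  B x /\ forall i, B (x * s i - lincomb (row i (vec_mx v)) s).
have relD v x v' x' : rel v x -> rel v' x' -> rel (v + v') (x + x').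
  move=> [Bx r] [Bx' r']; split=> [|i]; first exact: BD.
  by rewrite mulrDl !linearD /= lincombD opprD addrACA; apply: BD.
have relZ a v x : rel v x -> rel (a *: v) (a *: x).
  move=> [Bx r]; split=> [|i]; first exact: BZ.
  by rewrite -scalerAl !linearZ /= lincombZ -scalerBr; apply: BZ.
have rel0 : rel 0 0 by split=> // i; rewrite mul0r !linear0 lincomb0 subrr.
have [|h [C CP]] := noetherian_rV (P := fun v => exists x, rel v x) noethK.
  split=> [|v w [x rx] [y ry]|a v [x rx]]; first by exists 0.
    by exists (x + y); apply: relD.
  by exists (a *: x); apply: relZ.
have /boolp.choice[b bP] (l : 'I_h) : exists x, rel (row l C) x.
  by apply/CP; exists (delta_mx 0 l); rewrite -rowE.
have relC l : rel (l *m C) (lincomb l b).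
  rewrite mulmx_sum_row /lincomb; elim/big_ind2: _ => // [v x v' x'|i _].
    exact: relD.
  exact: relZ.
exists h, b; split=> [i|x Bx]; first by case: (bP i).
have /boolp.choice[c cP] i : exists c, B (x * s i - lincomb c s).
  have [c [t [Bt e]]] := span (SM _ _ (BS Bx) (Ss i)).
  by exists c; rewrite e addrC addKr.
have rx : rel (mxvec (\matrix_i c i)) x by split=> // i; rewrite mxvecK rowK.
have [|l xl] := (CP (mxvec (\matrix_i c i))).1; first by exists x.
(* Removing the combination of the [b i] from [x] leaves an element with zero matrix, which maps
   each [s i] into [B]. *)
have := relD _ _ _ _ rx (relZ (-1) _ _ (relC l)).
rewrite !scaleN1r xl subrr => -[Bt Bts].
exists l, (x - lincomb l b); split; last by rewrite addrC subrK.
split=> // y /span[d [t [By ->]]]; rewrite mulrDr; apply/BD; last exact: BM.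
rewrite mulr_sumr; apply: (big_ind B) => // i _; rewrite -scalerAr; apply: BZ.
by have := Bts i; rewrite !linear0 lincomb0 subr0.
Qed.

Lemma alg_fp_finite_corank : alg_fp S <-> alg_fp B.
Proof.
split; last exact: alg_fp_extension noethK subS subB BS Ss span.
have [h [b [Bb bspan]]] := conductor_span.
have modL := submodule_conductor.
have LB x : conductor B x -> B x by case.
have subL : subalgebra_pred (conductor B).
  by split=> // x y Lx /LB/BS; apply: conductor_right_ideal.
move=> fpS; apply: (alg_fp_extension noethK subB subL LB Bb bspan).
(* [s] spans [S] modulo [B] and [b] spans [B] modulo the conductor, so together they span [S] modulo
   the conductor. *)
pose s' (i : 'I_(k + h)) := match split i with inl j => s j | inr l => b l end.
apply: (alg_fp_right_ideal (s0 := s') modL) fpS => //.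
- by move=> x /LB/BS.
- exact: conductor_right_ideal.
- by move=> i; rewrite /s'; case: split => j //; apply: BS.
move=> x /span[c [t [/bspan[d [t' [Lt' ->]]] ->]]].
exists (row_mx c d), t'; split=> //; rewrite lincomb_row_mx addrA; congr (_ + _ + _).
  by apply: eq_lincomb => i; rewrite /s' -[lshift _ _]/(unsplit (inl _)) unsplitK.
by apply: eq_lincomb => i; rewrite /s' -[rshift _ _]/(unsplit (inr _)) unsplitK.
Qed.
End RightIdealOf.

(** * Return to non-unital algebras *)

Lemma fin_presented_finite_corank (K : comNzRingType) (A : lmodType K) (mul : A -> A -> A)
    (B : A -> Prop) :
    noetherian K -> is_algebra mul -> is_subalgebra mul B -> quotient_fin_gen B ->
  fin_presented mul (fun _ => True) <-> fin_presented mul B.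
Proof.
move=> noethK algA [B0 BD BZ BM] [s sP].
rewrite !(fin_presented_embed algA).
have subE (P : A -> Prop) : P 0 -> (forall x y, P x -> P y -> P (x + y)) ->
    (forall (k : K) x, P x -> P (k *: x)) -> (forall x y, P x -> P y -> P (mul x y)) ->
    subalgebra_pred (embed_pred (algA := algA) P).
  move=> P0 PD PZ PM; split; first split.
  - by apply/embed_predP; exists 0.
  - move=> _ _ /embed_predP[x Px ->] /embed_predP[y Py ->]; apply/embed_predP.
    by exists (x + y); rewrite ?linearD //; apply: PD.
  - move=> k _ /embed_predP[x Px ->]; apply/embed_predP.
    by exists (k *: x); rewrite ?linearZ //; apply: PZ.
  - move=> _ _ /embed_predP[x Px ->] /embed_predP[y Py ->]; apply/embed_predP.
    by exists (mul x y); rewrite ?embedM //; apply: PM.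
apply: (@alg_fp_finite_corank _ _ _ noethK _ _ _ (fun i : 'I_(size s) => embed algA s`_i)).
- exact: subE.
- exact: subE.
- by move=> _ /embed_predP[x Bx ->]; apply/embed_predP; exists x.
- by move=> i; apply/embed_predP; exists s`_i.
move=> _ /embed_predP[x _ ->]; have [c [b [Bb ->]]] := sP x.
exists (\row_i c i), (embed algA b); split; first by apply/embed_predP; exists b.
rewrite linearD linear_sum; congr (_ + _); apply: eq_bigr => i _.
by rewrite linearZ mxE.
Qed.

(** All scalars and vectors are [0], so the empty presentation works. *)
Lemma fin_presented_zero_ring (K : comPzRingType) (A : lmodType K) (mul : A -> A -> A)
    (B : A -> Prop) :
  (1 : K) = 0 -> fin_presented mul B.
Proof.
move=> K0; have K00 (k : K) : k = 0 by rewrite -[k]mul1r K0 mul0r.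
have A0 (x : A) : x = 0 by rewrite -[x]scale1r K0 scale0r.
exists 0%N, (fun=> 0), 0%N, (fun=> [::]); split=> [[]|[]|x _|p _] //.
  by exists [::]; split=> //; rewrite [LHS]A0 [RHS]A0.
by split=> _; [exists [::] => w; rewrite [LHS]K00 [RHS]K00 | apply: A0].
Qed.

(* MathComp's algebras are over nontrivial rings, so the zero ring is treated apart. *)
Lemma comNzRing_of_neq0 (K : comPzRingType) :
  (1 : K) != 0 -> exists K' : comNzRingType, K' = K :> comPzRingType.
Proof.
(* Unpacking [K] lets the richer structure be rebuilt on the same fields, so that forgetting
   nontriviality gives back [K] by conversion. *)
case: K => T [c1 c2 c3 c4 c5 c6 c7 c8 c9 c10 c11] K1.
pose K := GRing.ComPzRing.Pack
  (@GRing.ComPzRing.Class T c1 c2 c3 c4 c5 c6 c7 c8 c9 c10 c11).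
pose K' : comNzRingType := HB.pack (GRing.ComPzRing.sort K)
  (GRing.PzSemiRing_isNonZero.Build (GRing.ComPzRing.sort K) K1).
by exists K'.
Qed.

Theorem theorem1p1 (K : comPzRingType) (A : lmodType K) (mul : A -> A -> A)
    (B : A -> Prop) :
  noetherian K ->
  is_algebra mul ->
  is_subalgebra mul B ->
  quotient_fin_gen B ->
  (fin_presented mul (fun _ => True) <-> fin_presented mul B).
Proof.
have [K0 *|] := eqVneq (1 : K) 0; first by split=> _; apply: fin_presented_zero_ring.
by case/comNzRing_of_neq0=> K' KK'; move: A mul B; rewrite -KK'; apply: fin_presented_finite_corank.
Qed.
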